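(* Let $\phi:[0,\infty)\to[0,\infty)$ be a strictly increasing continuous function such that $\phi(0)=0$, $\phi(1)=1$ and, for some constants $\underline c,\overline c>0$ and $0<\underline\alpha\le\overline\alpha<2$, $$\underline c\left(\frac Rr\right)^{\underline\alpha}\le\frac{\phi(R)}{\phi(r)}\le\overline c\left(\frac Rr\right)^{\overline\alpha}\qquad\text{for every }0<r<R\le1.$$ Let $J\ge 0$ be a symmetric measurable function on $\{(x,y)\in\mathbb R^d\times\mathbb R^d:x\ne y\}$ and let $\kappa_1>0$ be a constant such that $$\frac{\kappa_1^{-1}}{|x-y|^d\phi(|x-y|)}\le J(x,y)\le\frac{\kappa_1}{|x-y|^d\phi(|x-y|)},\qquad 0<|x-y|\le1,$$ and $$\sup_{x\in\mathbb R^d}\int_{\{y\in\mathbb R^d:|x-y|>1\}}J(x,y)\,dy<\infty.$$ Let $$\mathcal E(u,u)=\frac12\int_{\mathbb R^d}\int_{\mathbb R^d}[u(y)-u(x)]^2J(x,y)\,dy\,dx,\qquad u\in L^2(\mathbb R^d,dx).$$ If $d\ge3$, then there is a constant $c>0$ such that $$\mathcal E(u,u)\ge c\int_{\mathbb R^d}u(x)^2\,\frac{dx}{\phi(|x|)\vee|x|^2},\qquad u\in L^2(\mathbb R^d).$$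
   Context: $a\vee b=\max(a,b)$. $\mathcal E$ is the quadratic form of the symmetric pure-jump Markov process on $\mathbb R^d$ with jump kernel $J$ (with Lebesgue measure as reference measure); it takes values in $[0,\infty]$. *)

(* Defs.v *)
From HB Require Import structures.
From mathcomp Require Import all_boot all_order all_algebra.
From mathcomp Require Import all_classical all_reals all_analysis.
Set Implicit Arguments.
Unset Strict Implicit.
Unset Printing Implicit Defensive.
Import Order.TTheory GRing.Theory Num.Theory.
Import numFieldNormedType.Exports.
Local Open Scope classical_set_scope.
Local Open Scope ring_scope.

(* R^d is [d.-tuple R]; its canonical measurable structure is the product
   sigma-algebra, i.e. the Borel one. *)

Definition eucl_norm (R : realType) (d : nat) (x : d.-tuple R) : R :=
  Num.sqrt (\sum_(i < d) tnth x i ^+ 2).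

Definition eucl_dist (R : realType) (d : nat) (x y : d.-tuple R) : R :=
  Num.sqrt (\sum_(i < d) (tnth x i - tnth y i) ^+ 2).

(* The library has no d-dimensional Lebesgue measure: it is built from the
   one-dimensional one and binary products, transported along
   (r, (x_1, .., x_n)) |-> (r, x_1, .., x_n). *)
Section lebesgue_cons.
Context (R : realType) (n : nat).
Variable mu : {sigma_finite_measure set (n.-tuple R) -> \bar R}.

Definition cons_pair (z : measurableTypeR R * n.-tuple R) : n.+1.-tuple R :=
  [tuple of z.1 :: z.2].

Lemma measurable_cons_pair :
  measurable_fun [set: measurableTypeR R * n.-tuple R] cons_pair.
Proof. by apply: measurable_cons; [exact: measurable_fst|exact: measurable_snd]. Qed.

Definition lebesgue_cons : set (n.+1.-tuple R) -> \bar R :=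
  pushforward (lebesgue_measure \x mu)%E cons_pair.

Let lebesgue_cons0 : lebesgue_cons set0 = 0%E.
Proof. by rewrite /lebesgue_cons /pushforward preimage_set0 measure0. Qed.

Let lebesgue_cons_ge0 A : (0 <= lebesgue_cons A)%E.
Proof. by rewrite /lebesgue_cons /pushforward measure_ge0. Qed.

Let lebesgue_cons_sigma_additive : semi_sigma_additive lebesgue_cons.
Proof.
move=> F mF tF mUF; rewrite /lebesgue_cons /pushforward preimage_bigcup.
apply: measure_semi_sigma_additive.
- by move=> k; rewrite -[X in measurable X]setTI; exact: measurable_cons_pair.
- apply/trivIsetP => /= i j _ _ ij; rewrite -preimage_setI.
  by move/trivIsetP : tF => /(_ _ _ _ _ ij) ->//; rewrite preimage_set0.
- rewrite -preimage_bigcup -[X in measurable X]setTI.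
  exact: measurable_cons_pair.
Qed.

HB.instance Definition _ := isMeasure.Build _ _ _ lebesgue_cons
  lebesgue_cons0 lebesgue_cons_ge0 lebesgue_cons_sigma_additive.

Let lebesgue_cons_sigma_finite : sigma_finite setT lebesgue_cons.
Proof.
have /sigma_finiteP[F [TF ndF Foo]] := sigma_finiteT (@lebesgue_measure R).
have /sigma_finiteP[G [TG ndG Goo]] := sigma_finiteT mu.
pose split (t : n.+1.-tuple R) : measurableTypeR R * n.-tuple R :=
  (thead t, [tuple of behead t]).
have splitK z : split (cons_pair z) = z.
  case: z => r x; rewrite /split /cons_pair theadE.
  by congr pair; exact: val_inj.
have msplit : measurable_fun [set: n.+1.-tuple R] split.
  apply: measurable_fun_pair; first exact: measurable_tnth.
  exact: measurable_behead.
exists (fun k => split @^-1` (F k `*` G k)) => [|k].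
  apply/esym; rewrite -subTset => t _.
  have [k _ Fk] : (\bigcup_k F k) (split t).1 by rewrite -TF.
  have [l _ Gl] : (\bigcup_k G k) (split t).2 by rewrite -TG.
  exists (maxn k l) => //; split.
    by move: Fk; exact/subsetPset/ndF/leq_maxl.
  by move: Gl; exact/subsetPset/ndG/leq_maxr.
have [mF Flty] := Foo k; have [mG Glty] := Goo k; split.
  by rewrite -[X in measurable X]setTI; apply: msplit => //; exact: measurableX.
rewrite /lebesgue_cons /pushforward (_ : cons_pair @^-1` _ = F k `*` G k).
  by rewrite product_measure1E// lte_mul_pinfty// ge0_fin_numE.
by apply/funext => z; rewrite /preimage/mkset splitK.
Qed.

HB.instance Definition _ := @Measure_isSigmaFinite.Build _ _ _ lebesgue_cons
  lebesgue_cons_sigma_finite.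

End lebesgue_cons.

Fixpoint lebesgue_Rd (R : realType) (d : nat) :
    {sigma_finite_measure set (d.-tuple R) -> \bar R} :=
  match d with
  | 0 => \d_([tuple] : 0.-tuple R)
  | n.+1 => lebesgue_cons (lebesgue_Rd R n)
  end.

(* J is only meaningful off the diagonal; on the diagonal the factor
   (u y - u x) ^+ 2 vanishes, so the value of J there is irrelevant. *)
Definition jump_form (R : realType) (d : nat) (J : d.-tuple R -> d.-tuple R -> R)
    (u : d.-tuple R -> R) : \bar R :=
  ((2^-1)%:E * \int[lebesgue_Rd R d]_x \int[lebesgue_Rd R d]_y
     ((u y - u x) ^+ 2 * J x y)%:E)%E.

(* Main.v *)
(** The weight is handled separately away from the origin and near it.

    Away from the origin: with [h = q^(-1/4)], [q x = 1600 + |x|^2], the pointwise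
    inequality
      [u(x)^2 + u(y)^2 <= (u(y) - u(x))^2 + u(x)^2 h(y)/h(x) + u(y)^2 h(x)/h(y)]
    is integrated over the pairs with [|x - y|_oo <= 1/d].  Since [d >= 3], [h] is
    strictly superharmonic and its average over such a cube is at most
    [(1 - c / q x) h(x)]; everything but [2 c u^2 / q] cancels.

    Near the origin: let [S_k] be [1/phi] at the inner radius times the integral
    of [u^2] over the shell [r b^-(k+1) < |x|_oo <= r b^-k].  Averaging
    [u(x)^2 <= 2 u(y)^2 + 2 (u(y) - u(x))^2] over two consecutive shells gives
    [S_(k+1) <= S_k / 2 + C e_k], where [e_k] is the energy of the inner shell: the
    volumes decrease like [b^-d] and [phi] at most like [b^-2], so a large ratio
    [b] produces the factor [1/2].  Summing over [k], only [S_0] remains, and it is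
    controlled by the first part. *)
Require Import Defs.
From HB Require Import structures.
From mathcomp Require Import all_boot all_order all_algebra.
From mathcomp Require Import all_classical all_reals all_analysis.
From mathcomp Require Import measurable_realfun ring lra.
Set Implicit Arguments.
Unset Strict Implicit.
Unset Printing Implicit Defensive.
Import Order.TTheory GRing.Theory Num.Theory.
Import numFieldNormedType.Exports.
Local Open Scope classical_set_scope.
Local Open Scope ring_scope.

(** * Integrals of squared affine functions over cubes *)

Lemma integral_sqr_affine_itv (R : realType) (x a al be c : R) : 0 < a ->
  (\int[lebesgue_measure]_(r in `[(x - a)%R, (x + a)%R]) ((al + c * (r - x)) ^+ 2 + be)%:E =
   (2 * a * (al ^+ 2 + be + a ^+ 2 / 3 * c ^+ 2))%:E)%E.
Proof.
move=> a0.
pose F r := (al ^+ 2 + be) * (r - x) + al * c * (r - x) ^+ 2 + c ^+ 2 / 3 * (r - x) ^+ 3.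
have dF r : is_derive r (1:R) F ((al + c * (r - x)) ^+ 2 + be).
  by rewrite /F; apply: is_derive_eq; rewrite /GRing.scale/=; field.
have cF : continuous F.
  by move=> r; apply/differentiable_continuous/derivable1_diffP; case: (dF r).
rewrite (@continuous_FTC2 _ _ F).
- by rewrite -EFinB; congr EFin; rewrite /F; field.
- lra.
- apply: continuous_subspaceT => r.
  by apply/differentiable_continuous/derivable1_diffP; exact: ex_derive.
- split => [r _||]; first by case: (dF r).
    exact/cvg_at_right_filter/cF.
  exact/cvg_at_left_filter/cF.
- by move=> r _; rewrite derive1E (@derive_val _ _ _ _ _ _ _ (dF r)).
Qed.

(** The closed sup-norm ball: it factors along the coordinates, which suits the recursive
    construction of [lebesgue_Rd]. *)
Definition cube (R : realType) (n : nat) (x : n.-tuple R) (a : R) : set (n.-tuple R) :=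
  [set y | forall i, `|tnth y i - tnth x i| <= a].

Lemma measurable_tnth_eucl (R : realType) (n : nat) (i : 'I_n) :
  measurable_fun [set: n.-tuple R] (fun y : n.-tuple R => tnth y i).
Proof. exact: measurable_tnth. Qed.

Lemma measurable_cube (R : realType) (n : nat) (x : n.-tuple R) (a : R) :
  measurable (cube x a).
Proof.
rewrite (_ : cube x a =
  \bigcap_(i in [set: 'I_n]) ((fun y : n.-tuple R => tnth y i) @^-1` `[tnth x i - a, tnth x i + a])).
  apply: fin_bigcap_measurable; first exact: finite_finset.
  move=> i _.
  rewrite -[X in measurable X]setTI; 
  exact: (@measurable_tnth_eucl R n i measurableT _ (measurable_itv _)).
apply/seteqP; split => y /= yx i => [_|]; last move: (yx i Logic.I);
  rewrite /= in_itv/= -ler_distlC distrC; [exact: yx|by []].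
Qed.

Lemma cube_cons (R : realType) (n : nat) (x y : n.-tuple R) (s r a : R) :
  cube [tuple of s :: x] a [tuple of r :: y] <-> `|r - s| <= a /\ cube x a y.
Proof.
split=> [h|[h0 h] i].
  by split=> [|i]; [have := h ord0|have := h (lift ord0 i)]; rewrite ?tnth0 ?tnthS.
by case: (unliftP ord0 i) => [j|] ->; rewrite ?tnth0 ?tnthS//; exact: h.
Qed.

(** The measure is by definition a push-forward of a product, so a change of variables followed by
    Tonelli isolates the first coordinate. *)
Lemma integral_lebesgue_RdS (R : realType) (n : nat) (f : n.+1.-tuple R -> \bar R) :
  measurable_fun setT f -> (forall y, 0 <= f y)%E ->
  (\int[lebesgue_Rd R n.+1]_y f y =
   \int[lebesgue_measure]_r \int[lebesgue_Rd R n]_y f [tuple of r :: y])%E.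
Proof.
move=> mf f0.
rewrite [LHS](@ge0_integral_pushforward _ _ _ _ _ _ (@measurable_cons_pair R n)
  (lebesgue_measure \x lebesgue_Rd R n)%E setT f)//.
rewrite preimage_setT fubini_tonelli1//.
- by apply: measurableT_comp => //; exact: measurable_cons_pair.
- by move=> z; exact: f0.
Qed.

Lemma measurable_sqr_affine (R : realType) (n : nat) (x : n.-tuple R) (al be : R)
    (c : 'I_n -> R) : measurable_fun [set: n.-tuple R]
  (fun y : n.-tuple R => (al + \sum_(i < n) c i * (tnth y i - tnth x i)) ^+ 2 + be).
Proof.
apply: measurable_funD => //; apply: measurable_funX.
apply: measurable_funD => //; apply: measurable_sum => i.
apply: measurable_funM => //; apply: measurable_funB => //.
exact: measurable_tnth_eucl.
Qed.

(** Induction on [n]: for a fixed first coordinate the inner integral has the same shape, with [al]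
    shifted by the linear term of that coordinate, and the outer one is [integral_sqr_affine_itv].
    Cross terms vanish by symmetry. Volumes and second moments of cubes are special cases. *)
Lemma integral_cube_sqr_affine (R : realType) (n : nat) (x : n.-tuple R) (a al be : R)
    (c : 'I_n -> R) : 0 < a -> 0 <= be ->
  (\int[lebesgue_Rd R n]_(y in cube x a)
     ((al + \sum_(i < n) c i * (tnth y i - tnth x i)) ^+ 2 + be)%:E =
   ((2 * a) ^+ n * (al ^+ 2 + be + a ^+ 2 / 3 * \sum_(i < n) c i ^+ 2))%:E)%E.
Proof.
move=> a0; elim: n x al be c => [|n IH] x al be c be0.
  rewrite (integral_dirac _ (measurable_cube x a)); last first.
    apply: measurable_funTS; apply/measurable_EFinP; exact: measurable_sqr_affine.
  rewrite diracE mem_set ?mul1e; last by case.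
  by rewrite !big_ord0 expr0 mul1r mulr0 !addr0.
case/tupleP: x => s x; rewrite integral_mkcond integral_lebesgue_RdS; last 2 first.
- apply: ((measurable_restrictT _ (measurable_cube _ _)).1 _).
  apply: measurable_funTS; apply/measurable_EFinP; exact: measurable_sqr_affine.
- by apply: erestrict_ge0 => y _; rewrite lee_fin addr_ge0// sqr_ge0.
rewrite -[RHS](_ : \int[lebesgue_measure]_(r in `[(s - a)%R, (s + a)%R])
  (((2 * a) ^+ n)%:E * ((al + c ord0 * (r - s)) ^+ 2 +
    (be + a ^+ 2 / 3 * \sum_(i < n) c (lift ord0 i) ^+ 2))%:E) = _)%E; last first.
  rewrite ge0_integralZl_EFin//.
  - rewrite integral_sqr_affine_itv// -EFinM; congr EFin.
    by rewrite big_ord_recl [(2 * a) ^+ n.+1]exprS; ring.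
  - move=> r _; rewrite lee_fin !addr_ge0// ?sqr_ge0//.
    by rewrite mulr_ge0 ?sumr_ge0// => [|i _]; rewrite ?sqr_ge0// divr_ge0// sqr_ge0.
  - apply/measurable_EFinP/measurable_funD => //; apply: measurable_funX.
    apply: measurable_funD => //; apply: measurable_funM => //.
    exact: measurable_funB.
  - by rewrite exprn_ge0// mulr_ge0// ltW.
rewrite [RHS]integral_mkcond; apply: eq_integral => r _.
rewrite patchE; case: ifPn => [|rs].
  rewrite inE/= in_itv/= -ler_distlC distrC => rs.
  rewrite -EFinM [in RHS]addrA -(IH x)//.
  rewrite [RHS]integral_mkcond; apply: eq_integral => y _.
  rewrite !patchE (_ : ([tuple of r :: y] \in _) = (y \in cube x a)).
    case: ifPn => // _; congr ((_ ^+ 2 + _)%:E).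
    rewrite big_ord_recl !tnth0 addrA; congr (_ + _).
    by apply: eq_bigr => i _; rewrite !tnthS.
  by apply/idP/idP; rewrite !inE cube_cons => // -[].
apply: integral0_eq => y _; rewrite patchE ifN//.
by rewrite notin_setE => /cube_cons[rs' _]; move: rs; rewrite notin_setE/=;
  rewrite in_itv/= -ler_distlC distrC.
Qed.

(** * Second-order expansion of [h] *)

(** Here [w] is [(1 + s)^(-1/4)], given through its fourth power. The exact second Taylor
    coefficient is [10 / 64]; the extra [1 / 64] absorbs the higher orders for [|s| <= 1 / 20]. It
    suffices that the right-hand side [T] satisfies [T ^+ 4 * (1 + s) >= 1]. *)
Lemma le_Taylor2_inv_root4 (R : realType) (w s : R) : `|s| <= 1 / 20 -> 0 <= w ->
  w ^+ 4 * (1 + s) = 1 -> w <= 1 - s / 4 + 11 / 64 * s ^+ 2.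
Proof.
rewrite ler_norml => /andP[s1 s2] w0 ws.
set T := 1 - s / 4 + 11 / 64 * s ^+ 2.
have [ss0 ss1] : 0 <= s ^+ 2 /\ s ^+ 2 <= 1 / 20 * (1 / 20).
  split; first exact: sqr_ge0.
  rewrite -real_normK ?num_real// -(expr2 (1 / 20)).
  by rewrite lerXn2r ?nnegrE ?ler_norml ?s1//; lra.
(* The [s ^+ 2] coefficient of [T ^+ 2] is [13 / 32], slightly above [2 / 5]; the difference
   [1 / 160] pays for the cubic term. *)
have T2 : 1 - s / 2 + 2 / 5 * s ^+ 2 <= T ^+ 2.
  rewrite -subr_ge0 (_ : _ - _ = s ^+ 2 * (1 / 160 - 11 / 128 * s) +
    (11 / 64 * s ^+ 2) ^+ 2); last by rewrite /T; field.
  by apply: addr_ge0; [apply: mulr_ge0; lra|exact: sqr_ge0].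
have T4 : 1 - s + 21 / 20 * s ^+ 2 - 2 / 5 * s ^+ 3 <= T ^+ 4.
  apply: (@le_trans _ _ ((1 - s / 2 + 2 / 5 * s ^+ 2) ^+ 2)).
    rewrite -subr_ge0 (_ : _ - _ = (2 / 5 * s ^+ 2) ^+ 2); last by field.
    exact: sqr_ge0.
  rewrite -[T ^+ 4]/(T ^+ (2 * 2)) exprM; apply: lerXn2r => //; rewrite nnegrE; last exact: sqr_ge0.
  lra.
have T1 : 1 <= T ^+ 4 * (1 + s).
  apply: (@le_trans _ _ ((1 - s + 21 / 20 * s ^+ 2 - 2 / 5 * s ^+ 3) * (1 + s))).
    rewrite -subr_ge0 (_ : _ - _ = s ^+ 2 * (1 / 20 + 13 / 20 * s - 2 / 5 * s ^+ 2)); last by field.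
    by apply: mulr_ge0; lra.
  by rewrite ler_wpM2r//; lra.
rewrite leNgt; apply/negP => Tw.
suff : T ^+ 4 * (1 + s) < w ^+ 4 * (1 + s) by lra.
rewrite ltr_pM2r; last by lra.
by rewrite ltrXn2r// /T; lra.
Qed.

(** The function [q]. The shift [40 * 40] keeps its relative variation over the cubes used below
    within [1 / 20], the range of the Taylor bound. *)
Definition shifted_sqnorm (R : realType) (d : nat) (x : d.-tuple R) : R :=
  40 * 40 + \sum_(i < d) tnth x i ^+ 2.

(* [h y / h x], where [h = shifted_sqnorm^(-1/4)]. *)
Definition root4_ratio (R : realType) (d : nat) (x y : d.-tuple R) : R :=
  Num.sqrt (Num.sqrt (shifted_sqnorm x)) / Num.sqrt (Num.sqrt (shifted_sqnorm y)).

Lemma shifted_sqnorm_ge (R : realType) (d : nat) (x : d.-tuple R) :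
  40 * 40 <= shifted_sqnorm x.
Proof. by rewrite lerDl sumr_ge0// => i _; exact: sqr_ge0. Qed.

Lemma root4_ratio_ge0 (R : realType) (d : nat) (x y : d.-tuple R) : 0 <= root4_ratio x y.
Proof. by rewrite divr_ge0. Qed.

Lemma root4_ratioX4 (R : realType) (d : nat) (x y : d.-tuple R) :
  root4_ratio x y ^+ 4 = shifted_sqnorm x / shifted_sqnorm y.
Proof.
have q0 z : 0 <= shifted_sqnorm z :> R by apply: le_trans (shifted_sqnorm_ge z); lra.
by rewrite expr_div_n !(exprM _ 2 2) !sqr_sqrtr.
Qed.

(* The second order Taylor bound, with the linear and quadratic terms in
   [y - x] completed to a square so that [integral_cube_sqr_affine] applies. *)
Lemma root4_ratio_le (R : realType) (d : nat) (x y : d.-tuple R) : (1 < d)%N ->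
  cube x d%:R^-1 y ->
  root4_ratio x y + (4 * shifted_sqnorm x)^-1 * \sum_(i < d) (tnth y i - tnth x i) ^+ 2 <=
  23 / 128 * ((- (16 / 23) + \sum_(i < d) (2 * tnth x i / shifted_sqnorm x) * (tnth y i - tnth x i)) ^+ 2
    + 128 / 23 * (21 / 23 + 4 / (d%:R ^+ 2 * shifted_sqnorm x ^+ 2))).
Proof.
move=> d0 yx; set q := shifted_sqnorm x; pose z i := tnth y i - tnth x i.
have dR : 2 <= d%:R :> R by rewrite ler_nat.
have q1 : 40 * 40 <= q by exact: shifted_sqnorm_ge.
set Z := \sum_(i < d) _; pose l : R := \sum_(i < d) 2 * tnth x i * z i.
have Z0 : 0 <= Z by rewrite sumr_ge0// => i _; exact: sqr_ge0.
have Zd : Z <= d%:R^-1.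
  apply: (@le_trans _ _ (\sum_(i < d) d%:R^-2)).
    by apply: ler_sum => i _; rewrite -real_normK ?num_real// -exprVn lerXn2r ?nnegrE ?invr_ge0 ?yx.
  rewrite sumr_const card_ord -[leLHS]mulr_natr le_eqVlt; apply/orP; left.
  by apply/eqP; field; lra.
have dV : d%:R^-1 <= 1 / 2 :> R by rewrite ler_pdivlMr ?ler_pdivrMl; lra.
have qy : shifted_sqnorm y = q + (l + Z).
  rewrite /shifted_sqnorm /q /shifted_sqnorm -addrA; congr (_ + _).
  by rewrite -!big_split/=; apply: eq_bigr => i _; rewrite /z; ring.
(* Termwise, [|2 x_i z_i| <= x_i^2 / 40 + 40 z_i^2]. *)
have lq : `|l + Z| <= q / 20.
  apply: (@le_trans _ _ (\sum_(i < d) (tnth x i ^+ 2 / 40 + 41 * z i ^+ 2))).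
    rewrite -big_split/=; apply: (le_trans (ler_norm_sum _ _ _)).
    apply: ler_sum => i _; rewrite -/(z i) ler_norml; apply/andP; split.
      by have := sqr_ge0 (tnth x i / 40 + z i); have := sqr_ge0 (z i); lra.
    by have := sqr_ge0 (tnth x i / 40 - z i); have := sqr_ge0 (z i); lra.
  rewrite big_split/= -mulr_suml -mulr_sumr -/Z.
  have : \sum_(i < d) tnth x i ^+ 2 <= q by rewrite lerDr.
  by lra.
pose s := (l + Z) / q.
have s1 : `|s| <= 1 / 20.
  by rewrite normrM normfV (gtr0_norm (_ : 0 < q)) ?ler_pdivrMr; lra.
have /le_trans-> // : root4_ratio x y + (4 * q)^-1 * Z <=
    1 - s / 4 + 11 / 64 * s ^+ 2 + (4 * q)^-1 * Z.
  rewrite lerD2r; apply: le_Taylor2_inv_root4 => //; first exact: root4_ratio_ge0.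
  rewrite root4_ratioX4 -/q qy /s.
  have : 0 < q + (l + Z) by move: lq; rewrite ler_norml; lra.
  by move=> ?; field; apply/andP; split; lra.
have -> : \sum_(i < d) 2 * tnth x i / q * (tnth y i - tnth x i) = l / q.
  by rewrite mulr_suml; apply: eq_bigr => i _; rewrite /z; ring.
(* Young's inequality with weight [22]: [11 / 64 * (23 / 22) = 23 / 128] is the target quadratic
   coefficient, and [11 / 64 * 23 < 4] covers the [Z] term. *)
have sE : s ^+ 2 <= 23 / 22 * (l / q) ^+ 2 + 23 * (Z / q) ^+ 2.
  rewrite /s mulrDl -subr_ge0 (_ : _ - _ = (l / q - 22 * (Z / q)) ^+ 2 / 22); last by field; lra.
  by apply: divr_ge0; [exact: sqr_ge0|lra].
have ZZ : (Z / q) ^+ 2 <= (d%:R ^+ 2 * q ^+ 2)^-1.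
  rewrite -exprMn -exprVn; apply: lerXn2r; rewrite ?nnegrE.
  - by apply: divr_ge0; lra.
  - by rewrite invr_ge0; apply: mulr_ge0; lra.
  - by rewrite invfM; apply: ler_wpM2r => //; rewrite invr_ge0; lra.
have := sqr_ge0 (Z / q); set D := (d%:R ^+ 2 * q ^+ 2)^-1 in ZZ *.
rewrite /s in sE *; set Q := (4 * q)^-1.
(* The part [Q * Z] of the first-order term is exactly the term added on the left-hand side, and
   cancels it. *)
have -> : (l + Z) / q / 4 = l / q / 4 + Q * Z by rewrite /Q; field; lra.
by lra.
Qed.

(** * General facts on nonnegative integrals *)

(** The integral of a nonnegative function is a supremum over the simple functions below it, hence
    monotone for arbitrary functions. This spares measurability checks on iterated integrals. *)
Lemma ge0_le_integral_nonmeas d (T : measurableType d) (R : realType)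
    (mu : {measure set T -> \bar R}) (D : set T) (f g : T -> \bar R) :
  (forall x, D x -> 0 <= f x)%E -> (forall x, D x -> f x <= g x)%E ->
  (\int[mu]_(x in D) f x <= \int[mu]_(x in D) g x)%E.
Proof.
move=> f0 fg; have g0 x : D x -> (0 <= g x)%E by move=> Dx; exact: le_trans (f0 _ Dx) (fg _ Dx).
rewrite 2!(integral_mkcond D) !ge0_integralTE; try exact: erestrict_ge0.
apply: le_ereal_sup => _ [h hf <-]; exists h => //= x.
apply: le_trans (hf x) _; rewrite !patchE; case: ifPn => //.
by rewrite inE; exact: fg.
Qed.

(** On nonnegative numbers, zero included, inversion is the real power of exponent [-1]. *)
Lemma measurable_fun_ge0_inv d (T : measurableType d) (R : realType) (f : T -> R) :
  measurable_fun setT f -> (forall x, 0 <= f x) -> measurable_fun setT (fun x => (f x)^-1).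
Proof.
move=> mf f0; rewrite (_ : (fun x => _) = (fun x => f x `^ (-1))).
  exact: (measurableT_comp (@measurable_powR R (-1)) mf).
by apply/funext => x; rewrite powR_inv1.
Qed.

Lemma ge0_integral_prod_swap d (T : measurableType d) (R : realType)
    (mu : {sigma_finite_measure set T -> \bar R}) (f : T * T -> \bar R) :
  measurable_fun setT f -> (forall z, 0 <= f z)%E ->
  (\int[mu \x mu]_z f (z.2, z.1) = \int[mu \x mu]_z f z)%E.
Proof.
move=> mf f0; rewrite fubini_tonelli1//.
- by rewrite fubini_tonelli2.
- apply: (measurableT_comp mf); exact: measurable_swap.
Qed.

(** * The mean of [h] over a cube *)

Lemma integral_cube_sqr_dist (R : realType) (n : nat) (x : n.-tuple R) (a : R) : 0 < a ->
  (\int[lebesgue_Rd R n]_(y in cube x a) (\sum_(i < n) (tnth y i - tnth x i) ^+ 2)%:E =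
   ((2 * a) ^+ n * (a ^+ 2 / 3) * n%:R)%:E)%E.
Proof.
move=> a0.
under eq_integral do rewrite -sumEFin.
rewrite ge0_integral_sum; last 3 first.
- exact: measurable_cube.
- move=> i; apply/measurable_EFinP; apply: measurable_funTS; apply: measurable_funX.
  by apply: measurable_funB => //; exact: measurable_tnth_eucl.
- by move=> i y _; rewrite lee_fin sqr_ge0.
rewrite (eq_bigr (fun=> ((2 * a) ^+ n * (a ^+ 2 / 3))%:E)).
  by rewrite sumEFin sumr_const card_ord mulr_natr.
move=> i _.
have := @integral_cube_sqr_affine R n x a 0 0 (fun j => (j == i)%:R) a0 (lexx _).
rewrite (bigD1 i)//= eqxx big1 => [|j /negPf->]; last by rewrite expr0n.
rewrite expr0n expr1n !addr0 add0r mulr1 => <-.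
apply: eq_integral => y _; congr (_ %:E).
rewrite (bigD1 i)//= eqxx big1 => [|j /negPf->]; last by rewrite mul0r.
by rewrite mul1r add0r !addr0.
Qed.

Lemma measurable_shifted_sqnorm (R : realType) (d : nat) :
  measurable_fun [set: d.-tuple R] (@shifted_sqnorm R d).
Proof.
apply: measurable_funD => //; apply: measurable_sum => i; apply: measurable_funX.
exact: measurable_tnth_eucl.
Qed.

Lemma measurable_root4_ratio (R : realType) (d : nat) :
  measurable_fun [set: d.-tuple R * d.-tuple R] (fun z => root4_ratio z.1 z.2).
Proof.
have ms : measurable_fun [set: d.-tuple R] (fun x => Num.sqrt (Num.sqrt (shifted_sqnorm x))).
  have msqrt := continuous_measurable_fun (@sqrt_continuous R).
  exact: (measurableT_comp msqrt (measurableT_comp msqrt (@measurable_shifted_sqnorm R d))).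
apply: measurable_funM.
  exact: (measurableT_comp ms measurable_fst).
apply: measurable_fun_ge0_inv => [|z]; last exact: sqrtr_ge0.
exact: (measurableT_comp ms measurable_snd).
Qed.

(** Strict superharmonicity of [h] in averaged form: over a centred cube the linear term of the
    expansion integrates to zero, and the gain [|y - x|^2 / (4 q)] outweighs the square of the
    linear term. *)
Lemma integral_cube_root4_ratio_le (R : realType) (d : nat) (x : d.-tuple R) : (2 < d)%N ->
  (\int[lebesgue_Rd R d]_(y in cube x d%:R^-1) (root4_ratio x y)%:E <=
   ((2 / d%:R) ^+ d * (1 - (192 * d%:R ^+ 2 * shifted_sqnorm x)^-1))%:E)%E.
Proof.
move=> d2; set q := shifted_sqnorm x; set v : R := (2 / d%:R) ^+ d.
have q1 : 40 * 40 <= q by exact: shifted_sqnorm_ge.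
have dR : 3 <= d%:R :> R by rewrite ler_nat.
have a0 : 0 < d%:R^-1 :> R by rewrite invr_gt0; lra.
have v0 : 0 <= v by apply: exprn_ge0; apply: divr_ge0; lra.
have mw : measurable_fun [set: d.-tuple R] (root4_ratio x).
  exact: (measurableT_comp (@measurable_root4_ratio R d) (measurable_pair1 x)).
pose X := \sum_(i < d) tnth x i ^+ 2.
have Xq : X <= q by rewrite lerDr; lra.
pose D := (d%:R ^+ 2 * q)^-1 : R.
have D0 : 0 <= D by rewrite invr_ge0; apply: mulr_ge0; [exact: sqr_ge0|lra].
(* The added constant is the integral of [|y - x|^2 / (4 q)]: with it the integrand becomes the
   left-hand side of [root4_ratio_le], whose right-hand side integrates exactly. *)
have : (\int[lebesgue_Rd R d]_(y in cube x d%:R^-1) (root4_ratio x y)%:E +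
    (v * (d%:R^-1 ^+ 2 / 3) * d%:R * (4 * q)^-1)%:E <=
    (v * (1 + 4 * D / q + 23 / 96 * D * (X / q)))%:E)%E.
  have -> : (v * (d%:R^-1 ^+ 2 / 3) * d%:R * (4 * q)^-1)%:E =
      (\int[lebesgue_Rd R d]_(y in cube x d%:R^-1)
        ((4 * q)^-1 * \sum_(i < d) (tnth y i - tnth x i) ^+ 2)%:E)%E.
    under eq_integral do rewrite EFinM.
    rewrite ge0_integralZl_EFin ?integral_cube_sqr_dist//.
    - by rewrite -EFinM mulrC.
    - exact: measurable_cube.
    - by move=> y _; rewrite lee_fin sumr_ge0// => i _; exact: sqr_ge0.
    - apply/measurable_EFinP; apply: measurable_funTS; apply: measurable_sum => i.
      by apply: measurable_funX; apply: measurable_funB => //; exact: measurable_tnth_eucl.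
    - by rewrite invr_ge0; lra.
  rewrite -ge0_integralD; last 5 first.
  - exact: measurable_cube.
  - by move=> y _; rewrite lee_fin root4_ratio_ge0.
  - by apply/measurable_EFinP; apply: measurable_funTS.
  - move=> y _; rewrite lee_fin; apply: mulr_ge0; first by rewrite invr_ge0; lra.
    by rewrite sumr_ge0// => i _; exact: sqr_ge0.
  - apply/measurable_EFinP; apply: measurable_funTS; apply: measurable_funM => //.
    apply: measurable_sum => i.
    by apply: measurable_funX; apply: measurable_funB => //; exact: measurable_tnth_eucl.
  pose be := 128 / 23 * (21 / 23 + 4 / (d%:R ^+ 2 * q ^+ 2)) : R.
  have be0 : 0 <= be.
    apply: mulr_ge0; first lra; apply: addr_ge0; first lra.
    by apply: divr_ge0; [lra|apply: mulr_ge0; exact: sqr_ge0].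
  have := @integral_cube_sqr_affine R d x d%:R^-1 (- (16 / 23)) be
    (fun i => 2 * tnth x i / q) a0 be0.
  move=> /(congr1 (fun e => (23 / 128)%:E * e)%E).
  rewrite -ge0_integralZl_EFin; last 4 first.
  - exact: measurable_cube.
  - by move=> y _; rewrite lee_fin; apply: addr_ge0 => //; exact: sqr_ge0.
  - by apply/measurable_EFinP; apply: measurable_funTS; exact: measurable_sqr_affine.
  - lra.
  rewrite -EFinM (_ : 23 / 128 * _ = v * (1 + 4 * D / q + 23 / 96 * D * (X / q))).
    move=> <-; apply: ge0_le_integral_nonmeas => y yx.
      rewrite adde_ge0// lee_fin ?root4_ratio_ge0//.
      apply: mulr_ge0; first by rewrite invr_ge0; lra.
      by rewrite sumr_ge0// => i _; exact: sqr_ge0.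
    by rewrite -EFinD -EFinM lee_fin; apply: root4_ratio_le => //; exact: ltnW.
  rewrite (_ : \sum_(i < d) _ = 4 * X / q ^+ 2).
    by rewrite /be /D /v; field; apply/andP; split; lra.
  rewrite (eq_bigr (fun i => 4 / q ^+ 2 * tnth x i ^+ 2)) => [|i _].
    by rewrite -mulr_sumr -/X; ring.
  by field; lra.
rewrite -leeBrDr//; move/le_trans; apply.
rewrite (_ : v * _ * _ * _ = v * (D * (d%:R / 12))); last first.
  by rewrite /D; field; apply/andP; split; lra.
rewrite (_ : (192 * _ * _)^-1 = D / 192); last by rewrite /D; field; apply/andP; split; lra.
rewrite -EFinB lee_fin -mulrBr; apply: ler_wpM2l => //.
(* The dimension enters here: in units of [D] the gain is [d / 12 >= 24 / 96] and the loss at most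
   [23 / 96 + 4 / q], with [4 / q <= 1 / 400]; the surplus exceeds [1 / 192]. *)
have qi : q^-1 <= (40 * 40)^-1 by rewrite lef_pV2 ?posrE; lra.
have Xqi : X / q <= 1 by rewrite ler_pdivrMr; lra.
have := ler_wpM2l D0 qi; have := ler_wpM2l D0 Xqi; have := ler_wpM2l D0 dR.
lra.
Qed.

(** * The weighted inequality away from the origin *)

Lemma measurable_cube_pair (R : realType) (n : nat) (a : R) :
  measurable [set z : n.-tuple R * n.-tuple R | cube z.1 a z.2].
Proof.
rewrite (_ : [set z | _] = \bigcap_(i in [set: 'I_n])
  ((fun z : n.-tuple R * n.-tuple R => tnth z.2 i - tnth z.1 i) @^-1` `[- a, a])).
  apply: fin_bigcap_measurable; first exact: finite_finset.
  move=> i _; rewrite -[X in measurable X]setTI.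
  suff mf : measurable_fun setT (fun z : n.-tuple R * n.-tuple R => tnth z.2 i - tnth z.1 i).
    exact: (mf measurableT _ (measurable_itv _)).
  apply: measurable_funB.
    exact: (measurableT_comp (@measurable_tnth_eucl R n i) measurable_snd).
  exact: (measurableT_comp (@measurable_tnth_eucl R n i) measurable_fst).
apply/seteqP; split => z /= zc i => [_|]; last move: (zc i Logic.I);
  by rewrite /= in_itv/= -ler_norml.
Qed.

Lemma cubeC (R : realType) (n : nat) (x y : n.-tuple R) (a : R) :
  cube x a y <-> cube y a x.
Proof. by split=> h i; rewrite distrC. Qed.

Lemma integral_cube_cst (R : realType) (n : nat) (x : n.-tuple R) (a c : R) :
  0 < a -> 0 <= c ->
  (\int[lebesgue_Rd R n]_(y in cube x a) c%:E = ((2 * a) ^+ n * c)%:E)%E.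
Proof.
move=> a0 c0.
have := @integral_cube_sqr_affine R n x a 0 c (fun=> 0) a0 c0.
rewrite big1 => [|i _]; last by rewrite expr0n.
rewrite mulr0 addr0 expr0n add0r => <-; apply: eq_integral => y _.
by rewrite big1 ?addr0 ?expr0n ?add0r// => i _; rewrite mul0r.
Qed.

Lemma shifted_sqnorm_gt0 (R : realType) (d : nat) (x : d.-tuple R) :
  0 < shifted_sqnorm x.
Proof. by have := shifted_sqnorm_ge x; lra. Qed.

(** The gap is a square divided by [w], zero when [b = a * w]; for [w = h(y) / h(x)] this is the
    case of [u] proportional to [h]. *)
Lemma sqrD_le_ground_state (R : realType) (a b w : R) : 0 < w ->
  a ^+ 2 + b ^+ 2 <= (b - a) ^+ 2 + (a ^+ 2 * w + b ^+ 2 * w^-1).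
Proof.
move=> w0; rewrite -subr_ge0 (_ : _ - _ = (a * w - b) ^+ 2 / w); last by field; lra.
by rewrite divr_ge0 ?sqr_ge0// ltW.
Qed.

(** The ground-state bound is integrated over the pairs in [K]. By symmetry both [F] terms agree and
    equal [P + Q], while superharmonicity bounds each [H] term by [P]; cancelling [P + P] leaves
    [Q + Q]. *)
Lemma sqr_integral_cube_le (R : realType) (d : nat) (u : d.-tuple R -> R) :
  (2 < d)%N -> measurable_fun setT u ->
  (\int[lebesgue_Rd R d]_x (u x ^+ 2)%:E < +oo)%E ->
  ((2 * (2 / d%:R) ^+ d * (192 * d%:R ^+ 2)^-1)%:E *
     \int[lebesgue_Rd R d]_x (u x ^+ 2 / shifted_sqnorm x)%:E <=
   \int[lebesgue_Rd R d]_x \int[lebesgue_Rd R d]_(y in cube x d%:R^-1)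
     ((u y - u x) ^+ 2)%:E)%E.
Proof.
move=> d2 mu ui; set mu0 := lebesgue_Rd R d; set v : R := (2 / d%:R) ^+ d.
set th : R := (192 * _)^-1.
have dR : 3 <= d%:R :> R by rewrite ler_nat.
have a0 : 0 < d%:R^-1 :> R by rewrite invr_gt0; lra.
have v0 : 0 <= v by apply: exprn_ge0; apply: divr_ge0; lra.
have th0 : 0 <= th by rewrite invr_ge0; apply: mulr_ge0; [lra|exact: sqr_ge0].
have thq (x : d.-tuple R) : 0 <= th / shifted_sqnorm x :> R.
  by apply: divr_ge0 => //; have := @shifted_sqnorm_ge R d x; lra.
have thq1 (x : d.-tuple R) : 0 <= 1 - th / shifted_sqnorm x :> R.
  have q1 := @shifted_sqnorm_ge R d x.
  rewrite subr_ge0 ler_pdivrMr; last lra.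
  apply: (@le_trans _ _ 1); last lra.
  rewrite invf_le1; last by apply: mulr_gt0; [lra|apply: exprn_gt0; lra].
  have : 1 <= d%:R ^+ 2 :> R by apply: exprn_ege1; lra.
  lra.
pose K : set (d.-tuple R * d.-tuple R) := [set z | cube z.1 d%:R^-1 z.2].
have mK : measurable K by exact: measurable_cube_pair.
(* With the restriction written as a symmetric factor, all integrals live on the full product space,
   where the coordinates can be swapped. *)
pose k (z : d.-tuple R * d.-tuple R) : R := \1_K z.
have mk : measurable_fun setT k by exact: measurable_indic.
have k0 z : 0 <= k z by rewrite /k indicE.
have kC z : k (z.2, z.1) = k z.
  by rewrite /k !indicE; congr ((nat_of_bool _)%:R); apply/idP/idP; rewrite !inE /K/= cubeC.
have mw := @measurable_root4_ratio R d.
have mu1 : measurable_fun setT (fun z : d.-tuple R * d.-tuple R => u z.1).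
  exact: (measurableT_comp mu measurable_fst).
have mu2 : measurable_fun setT (fun z : d.-tuple R * d.-tuple R => u z.2).
  exact: (measurableT_comp mu measurable_snd).
pose F z : \bar R := (k z * u z.1 ^+ 2)%:E.
pose H z : \bar R := (k z * (u z.1 ^+ 2 * root4_ratio z.1 z.2))%:E.
pose G z : \bar R := (k z * (u z.2 - u z.1) ^+ 2)%:E.
have mF : measurable_fun setT F.
  by apply/measurable_EFinP/measurable_funM => //; exact: measurable_funX.
have mH : measurable_fun setT H.
  apply/measurable_EFinP/measurable_funM => //; apply: measurable_funM => //.
  exact: measurable_funX.
have mG : measurable_fun setT G.
  apply/measurable_EFinP/measurable_funM => //; apply: measurable_funX.
  exact: measurable_funB.
have F0 z : (0 <= F z)%E by rewrite lee_fin mulr_ge0 ?sqr_ge0.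
have H0 z : (0 <= H z)%E by rewrite lee_fin mulr_ge0// mulr_ge0 ?sqr_ge0 ?root4_ratio_ge0.
have G0 z : (0 <= G z)%E by rewrite lee_fin mulr_ge0 ?sqr_ge0.
have ptw z : (F z + F (z.2, z.1) <= G z + (H z + H (z.2, z.1)))%E.
  rewrite /F /G /H -!EFinD lee_fin kC -!mulrDr; apply: ler_wpM2l => //=.
  rewrite (_ : root4_ratio z.2 z.1 = (root4_ratio z.1 z.2)^-1); last by rewrite invf_div.
  by apply: sqrD_le_ground_state; rewrite divr_gt0// !sqrtr_gt0 shifted_sqnorm_gt0.
have msw (f : d.-tuple R * d.-tuple R -> \bar R) : measurable_fun setT f ->
    measurable_fun setT (fun z => f (z.2, z.1)).
  by move=> mf; apply: (measurableT_comp mf); exact: measurable_swap.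
have : (\int[mu0 \x mu0]_z F z + \int[mu0 \x mu0]_z F z <=
    \int[mu0 \x mu0]_z G z + (\int[mu0 \x mu0]_z H z + \int[mu0 \x mu0]_z H z))%E.
  rewrite -{2}(ge0_integral_prod_swap mu0 mF)// -{2}(ge0_integral_prod_swap mu0 mH)//.
  have mF' := msw _ mF; have mH' := msw _ mH.
  rewrite -!ge0_integralD//.
  - by apply: ge0_le_integral_nonmeas => z _ //; rewrite adde_ge0.
  - by move=> z _; rewrite adde_ge0.
  - exact: emeasurable_funD.
have ->: (\int[mu0 \x mu0]_z G z = \int[mu0]_x \int[mu0]_(y in cube x d%:R^-1)
     ((u y - u x) ^+ 2)%:E)%E.
  rewrite fubini_tonelli1//; apply: eq_integral => x _.
  rewrite /fubini_F [RHS]integral_mkcond; apply: eq_integral => y _.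
  rewrite /G /k indicE patchE /= (_ : ((x, y) \in K) = (y \in cube x d%:R^-1)).
    by case: ifPn => _; rewrite ?mul1r ?mul0r.
  by apply/idP/idP; rewrite !inE.
pose P := (\int[mu0]_x (u x ^+ 2 * (v * (1 - th / shifted_sqnorm x)))%:E)%E.
pose Q := (\int[mu0]_x (u x ^+ 2 * (v * (th / shifted_sqnorm x)))%:E)%E.
have mthq : measurable_fun setT (fun x : d.-tuple R => th / shifted_sqnorm x).
  apply: measurable_funM => //; apply: measurable_fun_ge0_inv => [|x].
    exact: measurable_shifted_sqnorm.
  exact/ltW/shifted_sqnorm_gt0.
have mP : measurable_fun setT (fun x => (u x ^+ 2 * (v * (1 - th / shifted_sqnorm x)))%:E).
  apply/measurable_EFinP/measurable_funM; first exact: measurable_funX.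
  by apply: measurable_funM => //; exact: measurable_funB.
have mQ : measurable_fun setT (fun x => (u x ^+ 2 * (v * (th / shifted_sqnorm x)))%:E).
  apply/measurable_EFinP/measurable_funM; first exact: measurable_funX.
  exact: measurable_funM.
have P0 x : (0 <= (u x ^+ 2 * (v * (1 - th / shifted_sqnorm x)))%:E)%E.
  by rewrite lee_fin mulr_ge0 ?sqr_ge0// mulr_ge0.
have Q0 x : (0 <= (u x ^+ 2 * (v * (th / shifted_sqnorm x)))%:E)%E.
  by rewrite lee_fin mulr_ge0 ?sqr_ge0// mulr_ge0.
have FE : (\int[mu0 \x mu0]_z F z = P + Q)%E.
  rewrite -ge0_integralD// fubini_tonelli1//; apply: eq_integral => x _.
  rewrite -EFinD -mulrDr -mulrDr subrK mulr1 mulrC.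
  rewrite -(integral_cube_cst x a0 (sqr_ge0 (u x))) integral_mkcond; apply: eq_integral => y _.
  rewrite /F /k indicE patchE /= (_ : ((x, y) \in K) = (y \in cube x d%:R^-1)).
    by case: ifPn => _; rewrite ?mul1r ?mul0r.
  by apply/idP/idP; rewrite !inE.
have HP : (\int[mu0 \x mu0]_z H z <= P)%E.
  rewrite fubini_tonelli1//; apply: ge0_le_integral_nonmeas => x _.
    by apply: integral_ge0 => y _.
  rewrite [leRHS]EFinM; apply: (@le_trans _ _ ((u x ^+ 2)%:E *
     \int[mu0]_(y in cube x d%:R^-1) (root4_ratio x y)%:E)%E); last first.
    apply: lee_wpmul2l; first by rewrite lee_fin sqr_ge0.
    by rewrite -invfM; exact: integral_cube_root4_ratio_le.
  rewrite -ge0_integralZl_EFin ?sqr_ge0//; last 3 first.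
  - exact: measurable_cube.
  - by move=> y _; rewrite lee_fin root4_ratio_ge0.
  - apply/measurable_EFinP; apply: measurable_funTS.
    exact: (measurableT_comp mw (measurable_pair1 x)).
  rewrite [leRHS]integral_mkcond le_eqVlt; apply/orP; left; apply/eqP.
  apply: eq_integral => y _.
  rewrite /H /k indicE patchE /= (_ : ((x, y) \in K) = (y \in cube x d%:R^-1)).
    by case: ifPn => _; rewrite ?mul1r ?mul0r.
  by apply/idP/idP; rewrite !inE.
(* Cancellation in the extended reals needs finiteness, which comes from the square integrability of
   [u]. *)
have Pfin : P \is a fin_num.
  rewrite ge0_fin_numE; last exact: integral_ge0.
  apply: (@le_lt_trans _ _ (\int[mu0]_x (v%:E * (u x ^+ 2)%:E))%E).
    apply: ge0_le_integral_nonmeas => x _ //.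
    rewrite -EFinM lee_fin mulrC -mulrA; apply: ler_wpM2l => //.
    by apply: ler_piMl; [exact: sqr_ge0|rewrite gerBl].
  rewrite ge0_integralZl_EFin//; first exact: lte_mul_pinfty.
  - by move=> x _; rewrite lee_fin sqr_ge0.
  - by apply/measurable_EFinP; exact: measurable_funX.
have QE : Q = ((v * th)%:E * \int[mu0]_x (u x ^+ 2 / shifted_sqnorm x)%:E)%E.
  rewrite -ge0_integralZl_EFin//; last 3 first.
  - by move=> x _; rewrite lee_fin divr_ge0 ?sqr_ge0// ltW// shifted_sqnorm_gt0.
  - apply/measurable_EFinP; apply: measurable_funM; first exact: measurable_funX.
    apply: measurable_fun_ge0_inv => [|x]; first exact: measurable_shifted_sqnorm.
    exact/ltW/shifted_sqnorm_gt0.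
  - exact: mulr_ge0.
  by apply: eq_integral => x _; rewrite -EFinM; congr (_ %:E); ring.
rewrite FE addeACA => /le_trans => /(_ _ (leeD2l _ (leeD HP HP))).
rewrite [leRHS]addeC leeD2lE; last by rewrite fin_numD Pfin.
apply: le_trans; rewrite QE -mulrA mulr_natl mulr2n EFinD ge0_muleDl//.
  by rewrite lee_fin mulr_ge0.
by rewrite lee_fin mulr_ge0.
Qed.

(** * Averaging between two sets, and summation of the recursion *)

(** The pointwise inequality [u(x)^2 <= 2 u(y)^2 + 2 (u(y) - u(x))^2], whose gap is
    [(2 u(y) - u(x))^2], is integrated over [A] times [B]. *)
Lemma ge0_averaging d (T : measurableType d) (R : realType)
    (mu : {sigma_finite_measure set T -> \bar R}) (A B : set T) (u : T -> R) :
  measurable A -> measurable B -> measurable_fun setT u ->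
  (mu B * \int[mu]_(x in A) (u x ^+ 2)%:E <=
   2%:E * (mu A * \int[mu]_(x in B) (u x ^+ 2)%:E) +
   2%:E * \int[mu]_(x in A) \int[mu]_(y in B) ((u y - u x) ^+ 2)%:E)%E.
Proof.
move=> mA mB mu_.
have mu2 (D : set T) : measurable_fun D (fun x => (u x ^+ 2)%:E).
  by apply: measurable_funTS; apply/measurable_EFinP; exact: measurable_funX.
have u20 x : (0 <= (u x ^+ 2)%:E)%E by rewrite lee_fin sqr_ge0.
have d0 x y : (0 <= ((u y - u x) ^+ 2)%:E)%E by rewrite lee_fin sqr_ge0.
have md x (D : set T) : measurable_fun D (fun y => ((u y - u x) ^+ 2)%:E).
  apply: measurable_funTS; apply/measurable_EFinP; apply: measurable_funX.
  exact: measurable_funB.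
pose g x := (\int[mu]_(y in B) ((u y - u x) ^+ 2)%:E)%E.
have g0 x : (0 <= g x)%E by apply: integral_ge0.
have mg : measurable_fun setT g.
  (* Written this way, [g] is a section integral on the product space, measurable by Tonelli. *)
  pose f (z : T * T) : \bar R := (\1_B z.2 * (u z.2 - u z.1) ^+ 2)%:E.
  rewrite (_ : g = fubini_F mu f).
    apply: measurable_fun_fubini_tonelli_F => [|z].
      apply/measurable_EFinP; apply: measurable_funM.
        exact: (measurableT_comp (measurable_indic mB) measurable_snd).
      apply: measurable_funX; apply: measurable_funB.
        exact: (measurableT_comp mu_ measurable_snd).
      exact: (measurableT_comp mu_ measurable_fst).
    by rewrite lee_fin mulr_ge0 ?sqr_ge0// indicE.
  apply/funext => x; rewrite /g /fubini_F [LHS]integral_mkcond; apply: eq_integral => y _.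
  by rewrite /f indicE patchE /=; case: ifPn => _; rewrite ?mul1r ?mul0r.
rewrite -[X in (_ + 2%:E * X)%E]/(\int[mu]_(x in A) g x)%E.
have gE x : g x = (\int[mu]_(y in B) ((u y - u x) ^+ 2)%:E)%E by [].
clearbody g.
have -> : (mu B * \int[mu]_(x in A) (u x ^+ 2)%:E =
    \int[mu]_(x in A) \int[mu]_(y in B) (u x ^+ 2)%:E)%E.
  rewrite -ge0_integralZl//.
  by apply: eq_integral => x _; rewrite -[RHS]/(integral _ _ (cst _)) integral_cst// muleC.
have -> : (2%:E * (mu A * \int[mu]_(x in B) (u x ^+ 2)%:E) + 2%:E * \int[mu]_(x in A) g x =
    \int[mu]_(x in A) (\int[mu]_(y in B) (2 * u y ^+ 2)%:E + 2%:E * g x))%E.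
  rewrite ge0_integralD//.
  - congr (_ + _)%E; last by rewrite ge0_integralZl_EFin//; exact: measurable_funTS.
    rewrite -[RHS]/(integral _ _ (cst _)) integral_cst// muleCA muleC.
    congr (_ * _)%E; under [RHS]eq_integral do rewrite EFinM.
    by rewrite ge0_integralZl_EFin.
  - by move=> x _; apply: integral_ge0 => y _; rewrite lee_fin mulr_ge0 ?sqr_ge0.
  - by move=> x _; rewrite mule_ge0.
  - by apply: measurable_funTS; exact: emeasurable_funM.
apply: ge0_le_integral_nonmeas => x _; first exact: integral_ge0.
rewrite gE -ge0_integralZl_EFin// -ge0_integralD//.
- apply: ge0_le_integral_nonmeas => y _ //.
  rewrite -EFinM -EFinD lee_fin -subr_ge0.
  rewrite (_ : _ - _ = (2 * u y - u x) ^+ 2); last by ring.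
  exact: sqr_ge0.
- by move=> y _; rewrite lee_fin mulr_ge0 ?sqr_ge0.
- by under eq_fun do rewrite EFinM; apply: emeasurable_funM.
- by move=> y _; rewrite mule_ge0.
- exact: emeasurable_funM.
Qed.

Lemma nneseries_le_half_recursion (R : realType) (C : R) (S e : nat -> \bar R) :
  0 <= C -> (forall k, 0 <= S k)%E -> (forall k, 0 <= e k)%E ->
  (forall k, S k.+1 + S k.+1 <= S k + C%:E * e k)%E ->
  (\sum_(k <oo) S k <= 2%:E * S 0%N + C%:E * \sum_(k <oo) e k)%E.
Proof.
move=> C0 S0 e0 rec.
(* The last term is counted twice, so that one use of the recursion closes the induction without any
   subtraction. *)
have ind n : (\sum_(0 <= k < n.+1) S k + S n <=
    2%:E * S 0%N + C%:E * \sum_(0 <= k < n) e k)%E.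
  elim: n => [|n IH].
    by rewrite big_nat1 big_geq// mule0 adde0 mule_natl mule2n.
  rewrite big_nat_recr//= -addeA; apply: (le_trans (leeD2l _ (rec n))).
  rewrite addeA [in leRHS]big_nat_recr//= ge0_muleDr//; last exact: sume_ge0.
  by rewrite addeA; exact: leeD2r.
apply: lime_le; first by apply: is_cvg_nneseries.
apply: nearW => n; apply: (@le_trans _ _ (\sum_(0 <= k < n.+1) S k + S n)%E).
  rewrite big_nat_recr//= -addeA leeDl// adde_ge0//.
apply: (le_trans (ind n)); apply: leeD2l; apply: lee_wpmul2l => //.
exact: nneseries_lim_ge.
Qed.

(** * Sup-norm shells around the origin *)

Definition origin (R : realType) (d : nat) : d.-tuple R := nseq_tuple d 0.

Lemma cube_originP (R : realType) (d : nat) (r : R) (x : d.-tuple R) :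
  cube (origin R d) r x <-> forall i, `|tnth x i| <= r.
Proof. by split=> h i; have := h i; rewrite tnth_nseq subr0. Qed.

Lemma lebesgue_Rd_cube (R : realType) (n : nat) (x : n.-tuple R) (a : R) : 0 < a ->
  lebesgue_Rd R n (cube x a) = ((2 * a) ^+ n)%:E.
Proof.
move=> a0; have := integral_cube_cst x a0 ler01.
by rewrite -[X in X = _]/(integral _ _ (cst _)) integral_cst ?mul1e ?mulr1//; exact: measurable_cube.
Qed.

Definition shell (R : realType) (d : nat) (b r : R) : set (d.-tuple R) :=
  cube (origin R d) r `\` cube (origin R d) (r / b).

Lemma measurable_shell (R : realType) (d : nat) (b r : R) : measurable (@shell R d b r).
Proof. by apply: measurableD; exact: measurable_cube. Qed.

Lemma lebesgue_Rd_shell_le (R : realType) (d : nat) (b r : R) : 0 < r ->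
  (lebesgue_Rd R d (shell b r) <= ((2 * r) ^+ d)%:E)%E.
Proof.
move=> r0; rewrite -(lebesgue_Rd_cube (origin R d) r0); apply: le_measure.
- by rewrite inE; exact: measurable_shell.
- by rewrite inE; exact: measurable_cube.
- by move=> x [].
Qed.

(** For [b >= 2] and [d >= 1] the removed cube takes at most half of the volume. *)
Lemma lebesgue_Rd_shell_ge (R : realType) (d : nat) (b r : R) : (0 < d)%N -> 2 <= b -> 0 < r ->
  (((2 * r) ^+ d / 2)%:E <= lebesgue_Rd R d (shell b r))%E.
Proof.
move=> d0 b2 r0; have b0 : 0 < b by lra.
have rb : 0 < r / b by apply: divr_gt0.
have -> : lebesgue_Rd R d (shell b r) = (lebesgue_Rd R d (cube (origin R d) r) -
    lebesgue_Rd R d (cube (origin R d) (r / b)))%E.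
  apply: etrans (measureD _ _ _) _; [exact: measurable_cube..| |].
    by move: (ltry ((2 * r) ^+ d)); rewrite -(lebesgue_Rd_cube (origin R d) r0).
  rewrite setIidr// => x /cube_originP xr; apply/cube_originP => i.
  by apply: (le_trans (xr i)); rewrite ler_pdivrMr// ler_peMr; lra.
rewrite !lebesgue_Rd_cube// -EFinB lee_fin.
have : (2 * (r / b)) ^+ d <= (2 * r) ^+ d / 2.
  rewrite mulrA expr_div_n; apply: ler_wpM2l; first by apply: exprn_ge0; lra.
  rewrite lef_pV2 ?posrE ?exprn_gt0//.
  by rewrite -(prednK d0) exprS; apply: (le_trans b2); rewrite ler_peMr ?exprn_ege1; lra.
lra.
Qed.

Lemma cube_origin_le (R : realType) (d : nat) (r s : R) : r <= s ->
  cube (origin R d) r `<=` cube (origin R d) s.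
Proof.
by move=> rs x /cube_originP xr; apply/cube_originP => i; exact: le_trans (xr i) rs.
Qed.

Lemma trivIset_shell (R : realType) (d : nat) (b r : R) : 1 <= b -> 0 <= r ->
  trivIset setT (fun k => shell b (r / b ^+ k) : set (d.-tuple R)).
Proof.
move=> b1 r0; apply: ltn_trivIset => n m mn; rewrite -subset0 => x [[_ xm] [xn _]].
apply: xm; move: x xn; apply: cube_origin_le.
rewrite -mulrA -invfM -exprSr; apply: ler_wpM2l => //.
by rewrite lef_pV2 ?posrE ?exprn_gt0 ?(lt_le_trans ltr01)// ler_weXn2l.
Qed.

(** A point with a nonzero coordinate eventually leaves the shrinking cubes, and the last cube
    containing it determines its shell. *)
Lemma bigcup_shell (R : realType) (d : nat) (b r : R) : 2 <= b -> 0 < r ->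
  \bigcup_k (shell b (r / b ^+ k) : set (d.-tuple R)) =
  cube (origin R d) r `\ origin R d.
Proof.
move=> b2 r0; have b0 : 0 < b by lra.
apply/seteqP; split => [x [k _ [xk xk1]]|x [xr x0]].
  split.
    apply: cube_origin_le xk; rewrite ler_pdivrMr ?exprn_gt0//.
    by rewrite ler_peMr ?exprn_ege1; lra.
  move=> xo; apply: xk1; rewrite xo; apply/cube_originP => i.
  rewrite tnth_nseq normr0 divr_ge0 ?ltW// divr_gt0// exprn_gt0//.
have [i xi] : exists i, tnth x i != 0.
  apply: contrapT => /forallNP h; apply: x0; apply: eq_from_tnth => i.
  by rewrite tnth_nseq; apply/eqP/negP => /negP; exact: h.
have [k xk] : exists k, ~ cube (origin R d) (r / b ^+ k) x.
  (* An Archimedean bound suffices, since [k <= 2 ^ k <= b ^ k]. *)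
  pose k := Num.Def.archi_bound (r / `|tnth x i|).
  exists k => /cube_originP/(_ i); apply/negP; rewrite -ltNge.
  have xi0 : 0 < `|tnth x i| by rewrite normr_gt0.
  rewrite ltr_pdivrMr ?exprn_gt0// mulrC -ltr_pdivrMr//.
  apply: (@lt_le_trans _ _ k%:R); first by apply: archi_boundP; apply: divr_ge0; exact: ltW.
  apply: (@le_trans _ _ (2 ^+ k)); first by rewrite -natrX ler_nat ltnW// ltn_expl.
  by apply: lerXn2r => //; rewrite nnegrE; lra.
(* The least index of a cube missing [x] is positive because [x] lies in the cube of radius [r]; its
   predecessor [m] is the index of the shell. *)
pose P n := `[< ~ cube (origin R d) (r / b ^+ n) x >].
have exP : exists n, P n by exists k; apply/asboolP.
case: (ex_minnP exP) => -[/asboolP|m /asboolP xm minm].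
  by rewrite expr0 divr1 => /(_ xr).
exists m => //; split; last by move: xm; rewrite exprSr invfM mulrA.
apply: contrapT => xm'; have := minm m; rewrite ltnn => /(_ _)/negP; apply => //.
exact/asboolP.
Qed.

(** * Lower bounds for the jump kernel and its energy density *)

Lemma eucl_dist_cube_le (R : realType) (d : nat) (x y : d.-tuple R) (r : R) :
  0 <= r -> cube x r y -> eucl_dist x y <= d%:R * r.
Proof.
move=> r0 yx; rewrite -[leRHS]ger0_norm -?sqrtr_sqr; last exact: mulr_ge0.
apply: ler_wsqrtr; apply: (@le_trans _ _ (\sum_(i < d) r ^+ 2)).
  apply: ler_sum => i _; rewrite -real_normK ?num_real// distrC.
  by apply: lerXn2r; rewrite ?nnegrE.
rewrite sumr_const card_ord -[leLHS]mulr_natl [leRHS]exprMn; apply: ler_wpM2r; first exact: sqr_ge0.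
by rewrite -natrX ler_nat; case: d {x y yx} => // d; rewrite leq_pmulr.
Qed.

Lemma eucl_dist_gt0 (R : realType) (d : nat) (x y : d.-tuple R) :
  x <> y -> 0 < eucl_dist x y.
Proof.
move=> xy; rewrite sqrtr_gt0 lt0r sumr_ge0 ?andbT => [|i _]; last exact: sqr_ge0.
apply/negP => /eqP /psumr_eq0P H; apply: xy; apply: eq_from_tnth => i.
have := H (fun i _ => sqr_ge0 _) i isT.
by move=> /eqP; rewrite sqrf_eq0 subr_eq0 => /eqP.
Qed.

Lemma eucl_normX2 (R : realType) (d : nat) (x : d.-tuple R) :
  eucl_norm x ^+ 2 = \sum_(i < d) tnth x i ^+ 2.
Proof. by rewrite sqr_sqrtr// sumr_ge0// => i _; exact: sqr_ge0. Qed.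

Lemma norm_tnth_le_eucl_norm (R : realType) (d : nat) (x : d.-tuple R) (i : 'I_d) :
  `|tnth x i| <= eucl_norm x.
Proof.
rewrite -sqrtr_sqr; apply: ler_wsqrtr.
by rewrite (bigD1 i)//= lerDl sumr_ge0// => j _; exact: sqr_ge0.
Qed.

Lemma eucl_norm_gt_notin_cube (R : realType) (d : nat) (x : d.-tuple R) (r : R) :
  ~ cube (origin R d) r x -> r < eucl_norm x.
Proof.
move=> xr; rewrite ltNge; apply/negP => nxr; apply: xr; apply/cube_originP => i.
exact: le_trans (norm_tnth_le_eucl_norm x i) nxr.
Qed.

(** The cube of half-side [s / d] lies in the Euclidean ball of radius [s], and [t ^+ d * phi t] is
    monotone in [t]. *)
Lemma jump_kernel_ge (R : realType) (d : nat) (phi : R -> R) (kappa : R)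
    (J : d.-tuple R -> d.-tuple R -> R) (s : R) (x y : d.-tuple R) :
  (forall r, 0 < r -> 0 < phi r) ->
  (forall r t, 0 <= r -> r < t -> phi r < phi t) -> 0 < kappa ->
  (forall x y, 0 < eucl_dist x y -> eucl_dist x y <= 1 ->
     kappa^-1 / (eucl_dist x y ^+ d * phi (eucl_dist x y)) <= J x y) ->
  (0 < d)%N -> 0 < s <= 1 -> cube x (s / d%:R) y -> x <> y ->
  kappa^-1 / (s ^+ d * phi s) <= J x y.
Proof.
move=> phi_gt0 phi_incr k0 Jge d0 /andP[s0 s1] yx xy.
have dR : 0 < d%:R :> R by rewrite ltr0n.
have t0 := eucl_dist_gt0 xy.
have ts : eucl_dist x y <= s.
  apply: le_trans (eucl_dist_cube_le _ yx) _; first by apply: divr_ge0; exact: ltW.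
  by rewrite mulrC divfK// gt_eqF.
apply: le_trans (Jge _ _ t0 (le_trans ts s1)).
apply: ler_wpM2l; first by rewrite invr_ge0 ltW.
rewrite lef_pV2 ?posrE ?mulr_gt0 ?exprn_gt0 ?phi_gt0//.
apply: ler_pM; [by rewrite exprn_ge0// ltW|by rewrite ltW// phi_gt0| |].
  by apply: lerXn2r => //; rewrite nnegrE ltW.
by move: ts; rewrite le_eqVlt => /predU1P[->//|ts]; rewrite ltW// phi_incr// ltW.
Qed.

Definition jump_energy (R : realType) (d : nat) (J : d.-tuple R -> d.-tuple R -> R)
    (u : d.-tuple R -> R) (x : d.-tuple R) : \bar R :=
  (\int[lebesgue_Rd R d]_y ((u y - u x) ^+ 2 * J x y)%:E)%E.

Lemma jump_integrand_ge0 (R : realType) (d : nat) (J : d.-tuple R -> d.-tuple R -> R)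
    (u : d.-tuple R -> R) (x y : d.-tuple R) :
  (forall x y, x <> y -> 0 <= J x y) -> 0 <= (u y - u x) ^+ 2 * J x y.
Proof.
move=> J0; have [->|/eqP xy] := eqVneq x y; first by rewrite subrr expr0n mul0r.
by rewrite mulr_ge0 ?sqr_ge0// J0.
Qed.

Lemma jump_energy_ge0 (R : realType) (d : nat) (J : d.-tuple R -> d.-tuple R -> R)
    (u : d.-tuple R -> R) (x : d.-tuple R) :
  (forall x y, x <> y -> 0 <= J x y) -> (0 <= jump_energy J u x)%E.
Proof. by move=> J0; apply: integral_ge0 => y _; rewrite lee_fin jump_integrand_ge0. Qed.

(** [J] is measurable off the diagonal, and the integrand vanishes on it; the integrand thus equals
    its restriction to the complement of the diagonal. *)
Lemma measurable_jump_energy (R : realType) (d : nat) (J : d.-tuple R -> d.-tuple R -> R)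
    (u : d.-tuple R -> R) :
  measurable_fun [set z : d.-tuple R * d.-tuple R | z.1 <> z.2] (fun z => J z.1 z.2) ->
  (forall x y, x <> y -> 0 <= J x y) -> measurable_fun setT u ->
  measurable_fun setT (jump_energy J u).
Proof.
move=> mJ J0 mu.
pose F (z : d.-tuple R * d.-tuple R) := ((u z.2 - u z.1) ^+ 2 * J z.1 z.2)%:E.
apply: (@measurable_fun_fubini_tonelli_F _ _ _ _ _ (lebesgue_Rd R d) F) => [|z]; last first.
  by rewrite lee_fin jump_integrand_ge0.
pose D := [set z : d.-tuple R * d.-tuple R | z.1 <> z.2].
have mD : measurable D.
  (* The diagonal is the set of pairs at sup-distance at most [0]. *)
  rewrite (_ : D = ~` [set z | cube z.1 0 z.2]).
    by apply: measurableC; exact: measurable_cube_pair.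
  apply/seteqP; split => -[x y]/= xy; apply: contra_not xy.
    by move=> yx; apply: eq_from_tnth => i; have := yx i; rewrite normr_le0 subr_eq0 => /eqP->.
  by move=> /= -> i; rewrite subrr normr0.
rewrite (_ : F = F \_ D).
  apply: ((measurable_restrictT _ mD).1 _); apply/measurable_EFinP; apply: measurable_funM => //.
  apply: measurable_funTS; apply: measurable_funX; apply: measurable_funB.
    exact: (measurableT_comp mu measurable_snd).
  exact: (measurableT_comp mu measurable_fst).
apply/funext => z; rewrite patchE; case: ifPn => //.
by rewrite notin_setE/= => /contrapT zz; rewrite /F zz subrr expr0n mul0r.
Qed.

Lemma jump_energy_ge (R : realType) (d : nat) (J : d.-tuple R -> d.-tuple R -> R)
    (u : d.-tuple R -> R) (x : d.-tuple R) (D : set (d.-tuple R)) (c : R) :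
  (forall x y, x <> y -> 0 <= J x y) -> measurable_fun setT u -> measurable D ->
  0 <= c -> (forall y, D y -> x <> y -> c <= J x y) ->
  (c%:E * \int[lebesgue_Rd R d]_(y in D) ((u y - u x) ^+ 2)%:E <= jump_energy J u x)%E.
Proof.
move=> J0 mu mD c0 cJ; rewrite -ge0_integralZl_EFin//; last 2 first.
- by move=> y _; rewrite lee_fin sqr_ge0.
- apply: measurable_funTS; apply/measurable_EFinP; apply: measurable_funX.
  exact: measurable_funB.
rewrite integral_mkcond; apply: ge0_le_integral_nonmeas => y _.
  by apply: erestrict_ge0 => z _; rewrite -EFinM lee_fin mulr_ge0 ?sqr_ge0.
rewrite patchE; case: ifPn => [|_]; last by rewrite lee_fin jump_integrand_ge0.
rewrite inE => Dy; rewrite -EFinM lee_fin mulrC.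
have [->|/eqP xy] := eqVneq x y; first by rewrite subrr expr0n !mul0r.
by rewrite ler_wpM2l ?sqr_ge0// cJ.
Qed.

(** * The recursion between consecutive shells *)

(** For increasing [phi], the factor taken at the inner radius [r / b] dominates [1 / phi(|x|)] on
    the whole shell. *)
Definition weighted_shell (R : realType) (d : nat) (phi : R -> R) (u : d.-tuple R -> R)
    (b r : R) : \bar R :=
  ((phi (r / b))^-1%:E * \int[lebesgue_Rd R d]_(x in shell b r) (u x ^+ 2)%:E)%E.

(** [ge0_averaging] is applied with the inner shell as [A] and the outer one as [B]; the kernel
    bound turns the pair integral into energy of the inner shell. *)
Lemma shell_energy_step (R : realType) (d : nat) (phi : R -> R) (cu kappa b : R)
    (J : d.-tuple R -> d.-tuple R -> R) (u : d.-tuple R -> R) (rho : R) :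
  (2 < d)%N -> 0 < cu -> 0 < kappa ->
  (forall r, 0 < r -> 0 < phi r) ->
  (forall r t, 0 <= r -> r < t -> phi r < phi t) ->
  (forall r t, 0 < r -> r < t -> t <= 1 -> phi t <= cu * (t / r) ^+ 2 * phi r) ->
  measurable_fun [set z : d.-tuple R * d.-tuple R | z.1 <> z.2] (fun z => J z.1 z.2) ->
  (forall x y, x <> y -> 0 <= J x y) ->
  (forall x y, 0 < eucl_dist x y -> eucl_dist x y <= 1 ->
     kappa^-1 / (eucl_dist x y ^+ d * phi (eucl_dist x y)) <= J x y) ->
  measurable_fun setT u ->
  0 < rho -> 2 * d%:R * rho <= 1 ->
  2 <= b -> 8 * cu <= b ->
  (weighted_shell phi u b (rho / b) + weighted_shell phi u b (rho / b) <=
    weighted_shell phi u b rho +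
    (8 * kappa * d%:R ^+ d * cu * (2 * d%:R * b ^+ 2) ^+ 2)%:E *
      \int[lebesgue_Rd R d]_(x in shell b (rho / b)) jump_energy J u x)%E.
Proof.
move=> d2 cu0 k0 phi_gt0 phi_incr phi_sc mJ J0 Jge mu rho0 rho1 b2 bcu.
rewrite /weighted_shell.
have b0 : 0 < b by lra.
have d0 : (0 < d)%N by apply: leq_ltn_trans d2.
have dR : 3 <= d%:R :> R by rewrite ler_nat.
(* Points of the two shells differ by at most [2 * rho = s / d] in each coordinate, so
   [jump_kernel_ge] applies at scale [s]. *)
pose s := 2 * d%:R * rho; have s0 : 0 < s by apply: mulr_gt0 => //; lra.
have rb0 : 0 < rho / b by exact: divr_gt0.
have rbb0 : 0 < rho / b / b by exact: divr_gt0.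
have rb_lt : rho / b < rho by rewrite ltr_pdivrMr// ltr_pMr; lra.
have rbb_lt : rho / b / b < rho / b by rewrite ltr_pdivrMr// ltr_pMr; lra.
have rho_s : rho < s by rewrite ltr_pMl; lra.
have p0 : 0 < phi (rho / b) by exact: phi_gt0.
have pp0 : 0 < phi (rho / b / b) by exact: phi_gt0.
have ps0 : 0 < phi s by exact: phi_gt0.
have sc1 : phi (rho / b) <= cu * b ^+ 2 * phi (rho / b / b).
  rewrite [X in cu * X ^+ 2](_ : b = (rho / b) / (rho / b / b)); last by field; lra.
  by apply: phi_sc => //; rewrite -/s in rho1; lra.
have sc2 : phi s <= cu * (2 * d%:R * b ^+ 2) ^+ 2 * phi (rho / b / b).
  have -> : 2 * d%:R * b ^+ 2 = s / (rho / b / b) by rewrite /s; field; lra.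
  by apply: phi_sc => //; lra.
set A := shell b (rho / b); set B := shell b rho.
have mA : measurable A by exact: measurable_shell.
have mB : measurable B by exact: measurable_shell.
pose aA := (\int[lebesgue_Rd R d]_(x in A) (u x ^+ 2)%:E)%E.
pose aB := (\int[lebesgue_Rd R d]_(x in B) (u x ^+ 2)%:E)%E.
pose eA := (\int[lebesgue_Rd R d]_(x in A) jump_energy J u x)%E.
have aA0 : (0 <= aA)%E by apply: integral_ge0 => x _; rewrite lee_fin sqr_ge0.
have aB0 : (0 <= aB)%E by apply: integral_ge0 => x _; rewrite lee_fin sqr_ge0.
have eA0 : (0 <= eA)%E by apply: integral_ge0 => x _; exact: jump_energy_ge0.
pose c := kappa^-1 / (s ^+ d * phi s).
have c0 : 0 < c by apply: divr_gt0; rewrite ?invr_gt0// mulr_gt0// exprn_gt0.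
have pair_le : (\int[lebesgue_Rd R d]_(x in A) \int[lebesgue_Rd R d]_(y in B)
    ((u y - u x) ^+ 2)%:E <= (c^-1)%:E * eA)%E.
  rewrite -ge0_integralZl_EFin//; last 3 first.
  - by move=> x _; exact: jump_energy_ge0.
  - by apply: measurable_funTS; exact: measurable_jump_energy.
  - by rewrite invr_ge0 ltW.
  apply: ge0_le_integral_nonmeas => x [xA _].
    by apply: integral_ge0 => y _; rewrite lee_fin sqr_ge0.
  rewrite -lee_pdivrMl ?invr_gt0// invrK.
  apply: jump_energy_ge => //; first exact: ltW.
  move=> y [yB _] xy; apply: (jump_kernel_ge phi_gt0 phi_incr k0 Jge d0) => //.
    by rewrite s0.
  move=> i; rewrite (_ : s / d%:R = rho + rho); last by rewrite /s; field; lra.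
  apply: le_trans (ler_normB _ _) _; apply: lerD.
    exact: (cube_originP _ _).1 yB i.
  exact/ltW/(le_lt_trans _ rb_lt)/((cube_originP _ _).1 xA i).
have avg := ge0_averaging (lebesgue_Rd R d) mA mB mu.
have {}avg : (((2 * rho) ^+ d / 2)%:E * aA <=
    2%:E * (((2 * (rho / b)) ^+ d)%:E * aB) + 2%:E * ((c^-1)%:E * eA))%E.
  apply: (@le_trans _ _ (lebesgue_Rd R d B * aA)%E).
    by apply: lee_wpmul2r => //; exact: lebesgue_Rd_shell_ge.
  apply: (le_trans avg); apply: leeD; apply: lee_wpmul2l => //.
  by apply: lee_wpmul2r => //; exact: lebesgue_Rd_shell_le.
(* Chosen so that [m * ((2 * rho) ^+ d / 2)] is twice the weight of the inner shell. *)
pose m := 4 * (phi (rho / b / b))^-1 / (2 * rho) ^+ d.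
have V0 : 0 < (2 * rho) ^+ d by apply: exprn_gt0; lra.
have m0 : 0 < m by rewrite divr_gt0// mulr_gt0// invr_gt0.
have := lee_wpmul2l (x := m%:E) (ltW m0) avg.
have n1 : (0 <= 2%:E * (((2 * (rho / b)) ^+ d)%:E * aB))%E.
  apply: mule_ge0 => //; apply: mule_ge0 => //.
  by rewrite lee_fin; apply/exprn_ge0/mulr_ge0 => //; exact: ltW.
have n2 : (0 <= 2%:E * ((c^-1)%:E * eA))%E.
  by apply: mule_ge0 => //; apply: mule_ge0 => //; rewrite lee_fin invr_ge0 ltW.
rewrite (ge0_muleDr _ n1 n2).
rewrite !muleA -!EFinM.
have -> : m * ((2 * rho) ^+ d / 2) = (phi (rho / b / b))^-1 *+ 2.
  by rewrite /m; field; rewrite gt_eqF//= gt_eqF.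
have -> : ((phi (rho / b / b))^-1 *+ 2)%:E =
    ((phi (rho / b / b))^-1%:E + (phi (rho / b / b))^-1%:E)%E.
  by rewrite -EFinD mulr2n.
have q0 : (0 <= ((phi (rho / b / b))^-1)%:E)%E by rewrite lee_fin invr_ge0 ltW.
rewrite (ge0_muleDl _ q0 q0) => /le_trans; apply.
apply: leeD; apply: lee_wpmul2r => //; rewrite lee_fin.
(* The coefficient of the outer shell must not exceed its weight: [phi] loses at most [cu * b ^+ 2],
   and [8 * cu * b ^+ 2 <= b ^+ 3 <= b ^+ d] since [d >= 3]. *)
- have h : 8 * phi (rho / b) <= phi (rho / b / b) * b ^+ d.
    apply: (@le_trans _ _ (8 * (cu * b ^+ 2 * phi (rho / b / b)))); first by rewrite ler_pM2l.
    rewrite [leRHS]mulrC !mulrA; apply: ler_wpM2r; first exact: ltW.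
    apply: (@le_trans _ _ (b ^+ 3)); last by apply: ler_weXn2l => //; lra.
    by rewrite (exprS b 2) expr2 mulrA; do 2![apply: ler_wpM2r; first exact: ltW].
  rewrite (_ : m * 2 * _ = 8 / b ^+ d / phi (rho / b / b)).
    rewrite -[leRHS]mul1r ler_pdivlMr// mulrAC ler_pdivrMr// mul1r mulrAC.
    by rewrite ler_pdivrMr ?exprn_gt0.
  rewrite mulrA (expr_div_n (2 * rho)) /m; field.
  by rewrite (gt_eqF pp0) (gt_eqF V0) gt_eqF ?exprn_gt0.
(* The powers of [rho] cancel between [m] and [c], leaving a ratio of values of [phi] bounded by
   [sc2]: the constant is the same at all scales. *)
- rewrite (_ : m * 2 * _ = 8 * kappa * d%:R ^+ d * (phi s / phi (rho / b / b))).
    rewrite -(mulrA _ cu); apply: ler_wpM2l; last by rewrite ler_pdivrMr.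
    by rewrite !mulr_ge0 ?exprn_ge0// ltW.
  rewrite /c {1}/s (_ : 2 * d%:R * rho = d%:R * (2 * rho)); last by ring.
  rewrite exprMn /m; field.
  rewrite (gt_eqF pp0) (gt_eqF ps0) (gt_eqF V0) (gt_eqF k0) gt_eqF// exprn_gt0//; lra.
Qed.

(** * Combination of the two regions *)

Unset Implicit Arguments.

Theorem theorem13 (R : realType) (d : nat) (phi : R -> R)
    (cl cu al au kappa1 : R) (J : d.-tuple R -> d.-tuple R -> R)
    (phi_ge0 : forall r, 0 <= r -> 0 <= phi r)
    (phi_incr : forall r s, 0 <= r -> r < s -> phi r < phi s)
    (phi_cont : {within `[0, +oo[, continuous phi})
    (phi0 : phi 0 = 0) (phi1 : phi 1 = 1)
    (cl_gt0 : 0 < cl) (cu_gt0 : 0 < cu)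
    (al_gt0 : 0 < al) (al_le_au : al <= au) (au_lt2 : au < 2)
    (phi_scaling : forall r s, 0 < r -> r < s -> s <= 1 ->
      cl * (s / r) `^ al <= phi s / phi r /\
      phi s / phi r <= cu * (s / r) `^ au)
    (J_meas : measurable_fun [set z : d.-tuple R * d.-tuple R | z.1 <> z.2]
      (fun z => J z.1 z.2))
    (J_ge0 : forall x y, x <> y -> 0 <= J x y)
    (J_sym : forall x y, x <> y -> J x y = J y x)
    (kappa1_gt0 : 0 < kappa1)
    (J_near : forall x y, 0 < eucl_dist x y -> eucl_dist x y <= 1 ->
      kappa1^-1 / (eucl_dist x y ^+ d * phi (eucl_dist x y)) <= J x y /\
      J x y <= kappa1 / (eucl_dist x y ^+ d * phi (eucl_dist x y)))
    (J_far : (ereal_sup (range (fun x : d.-tuple R =>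
      \int[lebesgue_Rd R d]_(y in [set y | (1 < eucl_dist x y)%R]) (J x y)%:E)) < +oo)%E)
    (d_ge3 : (3 <= d)%N) :
  exists2 c : R, 0 < c & forall u : d.-tuple R -> R,
    u \in Lfun (lebesgue_Rd R d) 2%:E ->
    (c%:E * \int[lebesgue_Rd R d]_x
       (u x ^+ 2 / Num.max (phi (eucl_norm x)) (eucl_norm x ^+ 2))%:E
     <= jump_form J u)%E.
Proof.
have phi_gt0 r : 0 < r -> 0 < phi r by move=> r0; rewrite -phi0; exact: phi_incr.
(* As [s / r >= 1], the exponent [au < 2] may be raised to [2]. *)
have phi_sc r s : 0 < r -> r < s -> s <= 1 -> phi s <= cu * (s / r) ^+ 2 * phi r.
  move=> r0 rs s1; have [_] := phi_scaling r s r0 rs s1.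
  rewrite ler_pdivrMr ?phi_gt0// => /le_trans; apply.
  apply: ler_wpM2r; first exact/ltW/phi_gt0.
  apply: ler_wpM2l; first exact: ltW.
  have sr : 1 <= s / r by rewrite ler_pdivlMr// mul1r ltW.
  rewrite -powR_mulrn; last exact: le_trans ler01 sr.
  by rewrite ler_powR// ltW.
have Jge x y : 0 < eucl_dist x y -> eucl_dist x y <= 1 ->
    kappa1^-1 / (eucl_dist x y ^+ d * phi (eucl_dist x y)) <= J x y.
  by move=> xy0 xy1; have [] := J_near x y xy0 xy1.
have d0 : (0 < d)%N by apply: leq_ltn_trans d_ge3.
have dR : 3 <= d%:R :> R by rewrite ler_nat.
pose b := 2 + 8 * cu.
have b2 : 2 <= b by rewrite lerDl; lra.
have b0 : 0 < b by lra.
have bcu : 8 * cu <= b by rewrite /b; lra.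
(* The largest radius allowed by [2 * d * rho <= 1] in [shell_energy_step]. *)
pose r0 : R := (2 * d%:R)^-1.
have r00 : 0 < r0 by rewrite invr_gt0; lra.
pose r k := r0 / b ^+ k.
have rk0 k : 0 < r k by rewrite divr_gt0// exprn_gt0.
have rS k : r k.+1 = r k / b by rewrite /r exprSr invfM mulrA.
have rle k : r k <= r0.
  by rewrite ler_pdivrMr ?exprn_gt0// ler_peMr ?exprn_ege1 ?ltW//; lra.
pose cA := 2 * (2 / d%:R) ^+ d * (192 * d%:R ^+ 2)^-1 : R.
have cA0 : 0 < cA.
  rewrite mulr_gt0// ?invr_gt0; last by rewrite mulr_gt0 ?exprn_gt0; lra.
  by rewrite mulr_gt0// exprn_gt0// divr_gt0//; lra.
pose C := 8 * kappa1 * d%:R ^+ d * cu * (2 * d%:R * b ^+ 2) ^+ 2.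
have C0 : 0 <= C.
  by rewrite !mulr_ge0 ?exprn_ge0// ltW.
(* [C1] compares [q] with [|x|^2] outside the cube of radius [r0]; [C2] bounds [q] inside it. *)
pose C1 := 1 + 40 * 40 / r0 ^+ 2.
have C10 : 0 <= C1 by rewrite addr_ge0// divr_ge0 ?sqr_ge0//; lra.
pose C2 := 40 * 40 + d%:R * r0 ^+ 2.
have C20 : 0 <= C2 by rewrite addr_ge0// ?mulr_ge0 ?sqr_ge0//; lra.
pose C3 := (2 * ((phi (r0 / b))^-1 * C2) + C1) * (kappa1 / cA) + C.
have p10 : 0 < phi (r0 / b) by apply: phi_gt0; exact: divr_gt0.
have K0 : 0 <= 2 * ((phi (r0 / b))^-1 * C2).
  by apply: mulr_ge0 => //; apply: mulr_ge0 => //; rewrite invr_ge0 ltW.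
have kc0 : 0 <= kappa1 / cA by apply: divr_ge0; exact: ltW.
have KC0 : 0 <= (2 * ((phi (r0 / b))^-1 * C2) + C1) * (kappa1 / cA).
  by apply: mulr_ge0 => //; exact: addr_ge0.
have C30 : 0 < C3 + 1 by apply: ltr_wpDl => //; exact: addr_ge0.
(* The [2] matches the one half in [jump_form]; adding [1] to the nonnegative [C3] makes the
   constant positive. *)
exists (2 * (C3 + 1))^-1 => [|u uL2]; first by rewrite invr_gt0 mulr_gt0.
have mu : measurable_fun setT u.
  by move: uL2; rewrite inE => /andP[]; rewrite inE.
have ui : (\int[lebesgue_Rd R d]_x (u x ^+ 2)%:E < +oo)%E.
  have /integrableP[_] := Lfun2_integrable_sqr uL2.
  by under eq_integral do rewrite /= ger0_norm ?sqr_ge0//.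
set nu := lebesgue_Rd R d in ui *.
pose V x : R := u x ^+ 2 / Num.max (phi (eucl_norm x)) (eucl_norm x ^+ 2).
pose W := (\int[nu]_x (u x ^+ 2 / shifted_sqnorm x)%:E)%E.
pose E := (\int[nu]_x jump_energy J u x)%E.
have jE : jump_form J u = ((2^-1)%:E * E)%E by [].
have E0 : (0 <= E)%E by apply: integral_ge0 => x _; exact: jump_energy_ge0.
have mE : measurable_fun setT (jump_energy J u) by exact: measurable_jump_energy.
have V0 x : 0 <= V x by rewrite divr_ge0 ?sqr_ge0// le_max sqr_ge0 orbT.
have W0 : (0 <= W)%E.
  apply: integral_ge0 => x _.
  by rewrite lee_fin divr_ge0 ?sqr_ge0// ltW// shifted_sqnorm_gt0.
have mW D : measurable_fun D (fun x => (u x ^+ 2 / shifted_sqnorm x)%:E).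
  apply: measurable_funTS; apply/measurable_EFinP; apply: measurable_funM.
    exact: measurable_funX.
  apply: measurable_fun_ge0_inv => [|x]; first exact: measurable_shifted_sqnorm.
  exact/ltW/shifted_sqnorm_gt0.
have mV D : measurable_fun D (EFin \o V).
  apply: measurable_funTS; apply/measurable_EFinP; apply: measurable_funM.
    exact: measurable_funX.
  have mn2 : measurable_fun setT (fun x : d.-tuple R => \sum_(i < d) tnth x i ^+ 2).
    by apply: measurable_sum => i; apply: measurable_funX; exact: measurable_tnth_eucl.
  apply: measurable_fun_ge0_inv => [|x]; last by rewrite le_max sqr_ge0 orbT.
  have mn : measurable_fun setT (@eucl_norm R d).
    exact: (measurableT_comp (continuous_measurable_fun (@sqrt_continuous R)) mn2).
  apply: measurable_maxr; last exact: measurable_funX.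
  (* [phi] is monotone on the half-line; truncating its argument at [0] gives a monotone, hence
     measurable, function on the whole line. *)
  rewrite (_ : (fun x => _) = (fun t => phi (Num.max t 0)) \o @eucl_norm R d).
    apply: measurableT_comp => //; apply: nondecreasing_measurable => // s t st.
    have : Num.max s 0 <= Num.max t 0 by rewrite ge_max !le_max st lexx orbT.
    rewrite le_eqVlt => /predU1P[->//|/phi_incr/ltW]; apply.
    by rewrite le_max lexx orbT.
  by apply/funext => x /=; rewrite max_l// sqrtr_ge0.
(* On cubes of half-side [1 / d] the kernel is at least [kappa1^-1], by [jump_kernel_ge] at [s = 1]
   and [phi 1 = 1]. *)
have WE : (W <= (kappa1 / cA)%:E * E)%E.
  rewrite mulrC EFinM -muleA -lee_pdivrMl ?invr_gt0// invrK.
  apply: (le_trans (sqr_integral_cube_le d_ge3 mu ui)).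
  rewrite -ge0_integralZl_EFin//; last 2 first.
  - by move=> x _; exact: jump_energy_ge0.
  - exact: ltW.
  apply: ge0_le_integral_nonmeas => x _.
    by apply: integral_ge0 => y _; rewrite lee_fin sqr_ge0.
  rewrite -lee_pdivrMl//; apply: jump_energy_ge => //.
  - exact: measurable_cube.
  - by rewrite invr_ge0 ltW.
  - move=> y yx xy.
    have := @jump_kernel_ge R d phi kappa1 J 1 x y phi_gt0 phi_incr kappa1_gt0 Jge d0.
    by rewrite expr1n phi1 mulr1 divr1 div1r ltr01 lexx; apply.
pose S k := weighted_shell phi u b (r k).
have phir0 k : 0 < phi (r k / b) by apply: phi_gt0; rewrite divr_gt0.
have S0 k : (0 <= S k)%E.
  rewrite mule_ge0//; first by rewrite lee_fin invr_ge0 ltW.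
  by apply: integral_ge0 => x _; rewrite lee_fin sqr_ge0.
(* Index [k.+1]: the inner of the two shells compared at step [k]. *)
pose e k := (\int[nu]_(x in shell b (r k.+1)) jump_energy J u x)%E.
have e0 k : (0 <= e k)%E by apply: integral_ge0 => x _; exact: jump_energy_ge0.
have msh k : measurable (shell b (r k) : set (d.-tuple R)) by exact: measurable_shell.
have b1 : 1 <= b by lra.
have Ssum : (\sum_(k <oo) S k <= 2%:E * S 0%N + C%:E * E)%E.
  apply: (@le_trans _ _ (2%:E * S 0%N + C%:E * \sum_(k <oo) e k)%E).
    apply: nneseries_le_half_recursion => // k.
    rewrite /S /e rS; apply: shell_energy_step => //.
    apply: (@le_trans _ _ (2 * d%:R * r0)); first by apply: ler_wpM2l => //; lra.
    by rewrite mulfV//; lra.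
  apply: leeD2l; apply: lee_wpmul2l => //.
  (* The shells are disjoint, so their energies add up to at most [E]. *)
  rewrite /e -ge0_integral_bigcup//.
  - apply: ge0_subset_integral => //; first exact: bigcup_measurable.
    by move=> x _; exact: jump_energy_ge0.
  - exact: measurable_funTS.
  - by move=> x _; exact: jump_energy_ge0.
  - have tr := @trivIset_shell R d b r0 b1 (ltW r00).
    by move=> i j _ _ ij; have /(_ Logic.I Logic.I ij)[] := tr i.+1 j.+1.
have S0W : (S 0%N <= ((phi (r0 / b))^-1 * C2)%:E * W)%E.
  rewrite /S /weighted_shell {1}/r expr0 divr1 EFinM -muleA.
  apply: lee_wpmul2l; first by rewrite lee_fin invr_ge0 ltW.
  rewrite /W -ge0_integralZl_EFin//; last first.
    by move=> x _; rewrite lee_fin divr_ge0 ?sqr_ge0// ltW// shifted_sqnorm_gt0.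
  rewrite [leLHS]integral_mkcond; apply: ge0_le_integral_nonmeas => x _.
    by apply: erestrict_ge0 => y _; rewrite lee_fin sqr_ge0.
  rewrite patchE; case: ifPn => [|_]; last first.
    by rewrite -EFinM lee_fin mulr_ge0// divr_ge0 ?sqr_ge0// ltW// shifted_sqnorm_gt0.
  rewrite inE {1}/r expr0 divr1 => -[/cube_originP xr _].
  rewrite -EFinM lee_fin mulrCA ler_peMr ?sqr_ge0//.
  rewrite ler_pdivlMr ?shifted_sqnorm_gt0// mul1r; apply: lerD => //.
  apply: (@le_trans _ _ (\sum_(i < d) r0 ^+ 2)).
    apply: ler_sum => i _; rewrite -real_normK ?num_real//.
    by apply: lerXn2r; rewrite ?nnegrE// ltW.
  by rewrite sumr_const card_ord mulr_natl.
have near0 : (\int[nu]_(x in cube (origin R d) r0) (V x)%:E <= \sum_(k <oo) S k)%E.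
  have -> : (\int[nu]_(x in cube (origin R d) r0) (V x)%:E =
      \int[nu]_(x in \bigcup_k shell b (r k)) (V x)%:E)%E.
    rewrite bigcup_shell// integral_mkcond [RHS]integral_mkcond.
    apply: eq_integral => x _; rewrite !patchE in_setD in_set1.
    have [->|] := eqVneq x (origin R d); last by rewrite andbT.
    rewrite andbF; case: ifPn => // _; congr (_ %:E).
    (* At the origin the maximum is [0] and its inverse is [0] by convention, so the point missed by
       the shells contributes nothing. *)
    rewrite /V (_ : eucl_norm _ = 0) ?phi0 ?expr0n ?maxxx ?invr0 ?mulr0//.
    by rewrite /eucl_norm big1 ?sqrtr0// => i _; rewrite tnth_nseq expr0n.
  rewrite ge0_integral_bigcup//; last first.
  - exact: (@trivIset_shell R d b r0 b1 (ltW r00)).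
  - by move=> x _; rewrite lee_fin.
  apply: lee_nneseries => k _; first by move=> _; apply: integral_ge0 => x _; rewrite lee_fin.
  rewrite /S /weighted_shell -ge0_integralZl_EFin//; last 3 first.
  - by move=> x _; rewrite lee_fin sqr_ge0.
  - by apply: measurable_funTS; apply/measurable_EFinP; exact: measurable_funX.
  - by rewrite invr_ge0 ltW.
  apply: ge0_le_integral_nonmeas => x [_ /eucl_norm_gt_notin_cube xk]; first by rewrite lee_fin.
  rewrite -EFinM lee_fin [leRHS]mulrC; apply: ler_wpM2l; first exact: sqr_ge0.
  have h : phi (r k / b) <= Num.max (phi (eucl_norm x)) (eucl_norm x ^+ 2).
    by rewrite le_max ltW// phi_incr// ltW// divr_gt0.
  by rewrite lef_pV2// posrE// (lt_le_trans _ h).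
have far : (\int[nu]_(x in ~` cube (origin R d) r0) (V x)%:E <= C1%:E * W)%E.
  rewrite /W -ge0_integralZl_EFin//; last first.
    by move=> x _; rewrite lee_fin divr_ge0 ?sqr_ge0// ltW// shifted_sqnorm_gt0.
  rewrite [leLHS]integral_mkcond; apply: ge0_le_integral_nonmeas => x _.
    by apply: erestrict_ge0 => y _; rewrite lee_fin.
  rewrite patchE; case: ifPn => [|_]; last first.
    by rewrite -EFinM lee_fin mulr_ge0// divr_ge0 ?sqr_ge0// ltW// shifted_sqnorm_gt0.
  rewrite inE => /eucl_norm_gt_notin_cube xr.
  have n2 : r0 ^+ 2 <= eucl_norm x ^+ 2 by apply: lerXn2r; rewrite ?nnegrE ?sqrtr_ge0// ltW.
  have r20 : 0 < r0 ^+ 2 by exact: exprn_gt0.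
  have n20 : 0 < eucl_norm x ^+ 2 by exact: lt_le_trans n2.
  rewrite -EFinM lee_fin mulrCA; apply: ler_wpM2l; first exact: sqr_ge0.
  (* Far from the origin the maximum is bounded below by [|x|^2], and [|x| > r0] gives
     [q <= C1 |x|^2]. *)
  apply: (@le_trans _ _ (eucl_norm x ^+ 2)^-1).
    by rewrite lef_pV2 ?posrE// ?lt_max ?n20 ?orbT// le_max lexx orbT.
  rewrite ler_pdivlMr ?shifted_sqnorm_gt0// mulrC ler_pdivrMr//.
  rewrite /shifted_sqnorm -eucl_normX2 /C1 [leRHS]mulrDl mul1r [leLHS]addrC lerD2l.
  by rewrite -[leRHS]mulrA ler_peMr// mulrC ler_pdivlMr// mul1r.
have VE : (\int[nu]_x (V x)%:E <= C3%:E * E)%E.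
  rewrite -(setUv (cube (origin R d) r0)) ge0_integral_setU//; last 4 first.
  - exact: measurable_cube.
  - by apply: measurableC; exact: measurable_cube.
  - by move=> x _; rewrite lee_fin.
  - by rewrite disj_set2E setICr.
  apply: (le_trans (leeD (le_trans near0 Ssum) far)).
  rewrite addeAC; apply: (@le_trans _ _
    (((2 * ((phi (r0 / b))^-1 * C2)) + C1)%:E * W + C%:E * E)%E).
    apply: leeD => //; rewrite (EFinD (2 * _) C1) ge0_muleDl//.
    by apply: leeD => //; rewrite (EFinM 2) -muleA; exact: lee_wpmul2l.
  rewrite /C3 (EFinD _ C) ge0_muleDl//.
  apply: leeD => //; rewrite (EFinM _ (kappa1 / cA)) -muleA; apply: lee_wpmul2l => //.
  by rewrite lee_fin addr_ge0.
rewrite jE invfM EFinM -muleA; apply: lee_wpmul2l => //.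
rewrite lee_pdivrMl//; apply: (le_trans VE); apply: lee_wpmul2r => //.
by rewrite lee_fin lerDl.
Qed.
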